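(* For $t>1$ let $\mu_t\in V_{3,8}$ be defined by $$J_{\mu_t}(xZ_1+yZ_2+zZ_3)=\begin{bmatrix} 0&0&-x&-y&0&0&0&-z \\ 0&0&ty&-x&0&0&-z&0 \\ x&-ty&0&-x&0&-z&0&0 \\ y&x&x&0&-z&0&0&0 \\ 0&0&0&z&0&0&-x&-y \\ 0&0&z&0&0&0&y&-x \\ 0&z&0&0&x&-y&0&-x \\ z&0&0&0&y&x&x&0 \end{bmatrix}.$$ Then $\mu_t$, $t>1$, is a $1$-parameter family of pairwise non-isomorphic nonsingular algebras with Pfaffian forms given by $$f_{\mu_t}(x,y,z)=(x^2+y^2+z^2)(x^2+t\,y^2+z^2),$$ which do not admit a nilsoliton inner product.
   Context: Let $\mathfrak{n}=\mathfrak{n}_1\oplus\mathfrak{n}_2$ be a real inner product space with $\mathfrak{n}_1\perp\mathfrak{n}_2$ and orthonormal bases $\{X_1,\dots,X_8\}$ of $\mathfrak{n}_1$, $\{Z_1,Z_2,Z_3\}$ of $\mathfrak{n}_2$. $V_{3,8}=\Lambda^2\mathfrak{n}_1^*\otimes\mathfrak{n}_2$ is the space of bilinear skew-symmetric maps $\mu:\mathfrak{n}_1\times\mathfrak{n}_1\to\mathfrak{n}_2$, each regarded as a $2$-step nilpotent Lie bracket on $\mathfrak{n}$ (with $\mathfrak{n}_2$ central) and determined by the linear map $J_\mu:\mathfrak{n}_2\to\mathfrak{so}(\mathfrak{n}_1)$, $\langle J_\mu(Z)X,Y\rangle=\langle\mu(X,Y),Z\rangle$ (matrices are with respect to $\{X_i\}$).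 $\mu$ is nonsingular if $J_\mu(Z)$ is invertible for all $Z\neq0$. Isomorphic means isomorphic as Lie algebras. Pfaffian form: $f_\mu(x,y,z)=\operatorname{Pf}(J_\mu(xZ_1+yZ_2+zZ_3))$, where $\operatorname{Pf}:\mathfrak{so}(\mathfrak{n}_1)\to\mathbb{R}$ is the polynomial function with $\operatorname{Pf}(B)^2=\det B$ and $\operatorname{Pf}(J_0)=1$ for a fixed $J_0\in\mathfrak{so}(\mathfrak{n}_1)$ having only $\pm\mathrm{i}$ as eigenvalues; the choice of $J_0$ only affects the overall sign, which is here taken (uniformly in $t$) so that the form is positive. A nilsoliton inner product for $(\mathfrak{n},\mu)$ is an inner product on $\mathfrak{n}$ such that the corresponding left-invariant Riemannian metric $g$ on the simply connected nilpotent Lie group with Lie algebra $(\mathfrak{n},\mu)$ is a Ricci soliton, i.e. the Ricci flow solution starting at $g$ evolves only by time-dependent scaling and pull-back by diffeomorphisms; in this setting this is known to be equivalent to: the Ricci operator of $g$ equals $cI+D$ for some $c\in\mathbb{R}$ and some derivation $D$ of $(\mathfrak{n},\mu)$. *)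

(* Defs.v *)
(* MathComp; R : realType models the real numbers. *)
From HB Require Import structures.
From mathcomp Require Import all_boot all_order all_algebra.
From mathcomp Require Import sesquilinear boolp classical_sets reals.
From mathcomp Require Import complex ring.
From mathcomp Require mpoly.

Set Implicit Arguments.
Unset Strict Implicit.
Unset Printing Implicit Defensive.

Import Order.TTheory GRing.Theory Num.Theory.
Local Open Scope ring_scope.

(* Vectors are column vectors, so that a matrix [A] acts by [A *m X]. *)

Definition dotp (R : realType) n (u v : 'cV[R]_n) : R := \sum_i u i 0 * v i 0.

Definition is_skewmx (R : realType) n (B : 'M[R]_n) : Prop := B^T = - B.

(* The space Lambda^2 n1^* (x) n2, with n1 = R^p and n2 = R^q in coordinates
   with respect to the orthonormal bases; V_{3,8} is [skewbil R 8 3]. *)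
Record skewbil (R : realType) p q := Skewbil {
  skewbil_map :> {bilinear 'cV[R]_p -> 'cV[R]_p -> 'cV[R]_q};
  skewbilC : forall X Y, skewbil_map X Y = - skewbil_map Y X
}.

(* Entry (i, j) of J_mu(Z) is <J_mu(Z) X_j, X_i> = <mu(X_j, X_i), Z>. *)
Definition Jmap (R : realType) p q (mu : skewbil R p q) (Z : 'cV[R]_q) : 'M[R]_p :=
  \matrix_(i, j) dotp (mu (delta_mx j 0) (delta_mx i 0)) Z.

Definition nonsingular (R : realType) p q (mu : skewbil R p q) : Prop :=
  forall Z, Z != 0 -> Jmap mu Z \in unitmx.

(* The 2-step nilpotent bracket of mu on n = n1 (+) n2. *)
Definition bracket (R : realType) p q (mu : skewbil R p q)
    (u v : 'cV[R]_(p + q)) : 'cV[R]_(p + q) :=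
  col_mx 0 (mu (usubmx u) (usubmx v)).

Definition lie_isomorphic (R : realType) n (br1 br2 : 'cV[R]_n -> 'cV[R]_n -> 'cV[R]_n)
    : Prop :=
  exists phi : {linear 'cV[R]_n -> 'cV[R]_n},
    bijective phi /\ forall u v, phi (br1 u v) = br2 (phi u) (phi v).

Definition is_derivation (R : realType) n (br : 'cV[R]_n -> 'cV[R]_n -> 'cV[R]_n)
    (D : 'cV[R]_n -> 'cV[R]_n) : Prop :=
  forall u v, D (br u v) = br (D u) v + br u (D v).

Section Pfaffian.
Variables (R : realType) (n : nat).
Implicit Types (B : 'M[R]_n) (pf : 'M[R]_n -> R).

Definition only_pm_i_eigenvalues (J0 : 'M[R]_n) : Prop :=
  forall a : R[i], eigenvalue (map_mx (real_complex R) J0) a ->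
    a = 'i%C \/ a = - 'i%C.

Definition polynomial_on_so pf : Prop :=
  exists P : mpoly.mpoly (n * n) R,
    forall B, is_skewmx B -> pf B = mpoly.meval (fun k => mxvec B 0 k) P.

Definition is_pfaffian (J0 : 'M[R]_n) pf : Prop :=
  [/\ polynomial_on_so pf,
      forall B, is_skewmx B -> pf B ^+ 2 = \det B
    & pf J0 = 1].

(* "The" Pfaffian normalized at J0, chosen among the functions satisfying
   [is_pfaffian J0]; these all agree on skew-symmetric matrices, and their
   values elsewhere are irrelevant. *)
Definition pfaffian (J0 : 'M[R]_n) : 'M[R]_n -> R :=
  xget (fun=> 0) [set pf | is_pfaffian J0 pf].

End Pfaffian.

(* xZ_1 + yZ_2 + zZ_3 *)
Definition vec3 (R : realType) (x y z : R) : 'cV[R]_3 :=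
  x *: delta_mx 0 0 + y *: delta_mx 1 0 + z *: delta_mx 2%:R 0.

Definition pfaffian_form (R : realType) p (J0 : 'M[R]_p) (mu : skewbil R p 3)
    (x y z : R) : R :=
  pfaffian J0 (Jmap mu (vec3 x y z)).

(* Curvature of the left-invariant metric on the simply connected Lie group with
   Lie algebra (R^n, br) given by the inner product g, evaluated on
   left-invariant vector fields. *)
Section LeftInvariantMetric.
Variables (R : realType) (n : nat).
Local Notation V := 'cV[R]_n.
Variables (br : V -> V -> V) (g : {dot V for idfun}).

Definition gram : 'M[R]_n := \matrix_(i, j) g (delta_mx i 0) (delta_mx j 0).

(* The vector representing the linear form l, i.e. g (riesz l) w = l w. *)
Definition riesz (l : V -> R) : V := invmx gram *m \col_i l (delta_mx i 0).

(* Koszul formula (the terms differentiating constant functions vanish). *)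
Definition levi_civita (u v : V) : V :=
  riesz (fun w => 2^-1 * (g (br u v) w - g (br v w) u + g (br w u) v)).

Definition riemann (u v w : V) : V :=
  levi_civita u (levi_civita v w) - levi_civita v (levi_civita u w)
  - levi_civita (br u v) w.

Definition endo_trace (f : V -> V) : R := \sum_i f (delta_mx i 0) i 0.

Definition ricci (u v : V) : R := endo_trace (fun w => riemann w u v).

Definition ricci_op (u : V) : V := riesz (ricci u).

Definition is_nilsoliton : Prop :=
  exists (c : R) (D : {linear V -> V}),
    is_derivation br D /\ forall u, ricci_op u = c *: u + D u.

End LeftInvariantMetric.

Section LeftInvariantMetricTheory.
Variables (R : realType) (n : nat).
Local Notation V := 'cV[R]_n.
Variable g : {dot V for idfun}.

Lemma dot_sym (u v : V) : g u v = g v u.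
Proof. by rewrite hermC expr0 mul1r. Qed.

Lemma dot_linearl (a : R) (u v w : V) : g (a *: u + v) w = a * g u w + g v w.
Proof. by rewrite linearDl linearZl_LR. Qed.

Lemma dot_linearr (a : R) (u v w : V) : g w (a *: u + v) = a * g w u + g w v.
Proof. by rewrite dot_sym dot_linearl !(dot_sym w). Qed.

Lemma dot_suml (F : 'I_n -> R) (v : V) (e : 'I_n -> V) :
  g (\sum_i F i *: e i) v = \sum_i F i * g (e i) v.
Proof. by rewrite linear_sumlz; apply: eq_bigr => i _; rewrite linearZl_LR. Qed.

Lemma col_sum_delta (w : V) : w = \sum_i w i 0 *: delta_mx i 0.
Proof.
apply/matrixP => i j; rewrite ord1 summxE (bigD1 i) //= big1 => [|k /negPf ki].
  by rewrite !mxE !eqxx mulr1 addr0.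
by rewrite !mxE eq_sym ki mulr0.
Qed.

Lemma gramE (u w : V) : g u w = (u^T *m gram g *m w) 0 0.
Proof.
rewrite {1}[u]col_sum_delta dot_suml -mulmxA mxE; apply: eq_bigr => i _.
rewrite !mxE; congr (_ * _).
rewrite {1}[w]col_sum_delta dot_sym dot_suml; apply: eq_bigr => j _.
by rewrite !mxE mulrC dot_sym.
Qed.

Lemma gram_unit : gram g \in unitmx.
Proof.
rewrite -row_free_unit -kermx_eq0; apply/negPn/negP => /rowV0Pn [u].
move=> /sub_kermxP uG u0.
have u1 : u^T != 0 by apply: contra u0 => /eqP u0; rewrite -[u]trmxK u0 trmx0.
have := neq0_dnorm_gt0 (s := g) _ u1.
by rewrite gramE trmxK uG mul0mx mxE ltxx.
Qed.

Lemma rieszP (l : V -> R) (w : V) : scalar l -> g (riesz g l) w = l w.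
Proof.
move=> hl.
have l0 : l 0 = 0 by have := hl (-1) 0 0; rewrite scaler0 addr0 mulN1r addNr.
have lS (F : 'I_n -> R) (e : 'I_n -> V) (s : seq 'I_n) :
    l (\sum_(i <- s) F i *: e i) = \sum_(i <- s) F i * l (e i).
  by elim: s => [|i s IH]; rewrite ?big_nil // !big_cons hl IH.
rewrite dot_sym gramE /riesz -!mulmxA (mulmxA (gram g)) mulmxV ?gram_unit //.
rewrite mul1mx mxE [in RHS](col_sum_delta w) lS.
by apply: eq_bigr => i _; rewrite !mxE.
Qed.

Variable br : {bilinear V -> V -> V}.
Hypothesis brC : forall u v, br u v = - br v u.

Lemma levi_civitaP (u v w : V) : g (levi_civita br g u v) w =
  2^-1 * (g (br u v) w - g (br v w) u + g (br w u) v).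
Proof.
apply: rieszP => a x y; rewrite dot_linearr.
have -> : br v (a *: x + y) = a *: br v x + br v y by rewrite linearDr linearZr_LR.
have -> : br (a *: x + y) u = a *: br x u + br y u by rewrite linearDl linearZl_LR.
rewrite !dot_linearl; ring.
Qed.

Lemma dot_inj (u v : V) : (forall w, g u w = g v w) -> u = v.
Proof.
move=> uv; apply/eqP; rewrite -subr_eq0; apply/negPn/negP => h.
have := neq0_dnorm_gt0 (s := g) _ h.
by rewrite linearBl /= uv subrr ltxx.
Qed.

Lemma levi_civita_torsion_free (u v : V) :
  levi_civita br g u v - levi_civita br g v u = br u v.
Proof.
apply: dot_inj => w; rewrite linearBl /= !levi_civitaP.
rewrite (brC v u) (brC u w) (brC w v) !linearNl /=; field => //.
Qed.

Lemma levi_civita_metric (u v w : V) :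
  g (levi_civita br g u v) w + g v (levi_civita br g u w) = 0.
Proof.
rewrite (dot_sym v) !levi_civitaP (brC u w) (brC v u) (brC w v) !linearNl /=.
ring.
Qed.

End LeftInvariantMetricTheory.

Section FromJ.
Variables (R : realType) (p q : nat).

(* The mu with <mu(X, Y), Z> = <J(Z) X, Y>, given by the matrices J(Z_k). *)
Definition mu_of (J : 'I_q -> 'M[R]_p) (X Y : 'cV[R]_p) : 'cV[R]_q :=
  \col_k dotp (J k *m X) Y.

Variable J : 'I_q -> 'M[R]_p.

Lemma mu_of_bilinear : bilinear_for *:%R *:%R (mu_of J).
Proof.
split=> [Y|X] a u v; apply/colP => k; rewrite !mxE /dotp mulr_sumr -big_split /=;
  apply: eq_bigr => i _; rewrite ?linearD ?linearZ /= !mxE; ring.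
Qed.

HB.instance Definition _ :=
  bilinear_isBilinear.Build R _ _ _ *:%R *:%R (mu_of J) mu_of_bilinear.

Hypothesis J_skew : forall k, is_skewmx (J k).

Lemma mu_of_skew X Y : mu_of J X Y = - mu_of J Y X.
Proof.
apply/colP => k; rewrite !mxE /dotp.
have E (U W : 'cV[R]_p) : \sum_i U i 0 * W i 0 = (U^T *m W) 0 0.
  by rewrite mxE; apply: eq_bigr => i _; rewrite mxE.
have -> : \sum_i (J k *m Y) i 0 * X i 0 = \sum_i X i 0 * (J k *m Y) i 0.
  by apply: eq_bigr => i _; rewrite mulrC.
by rewrite !E trmx_mul J_skew mulmxN mulNmx mxE mulmxA.
Qed.

Definition skewbil_of : skewbil R p q := Skewbil mu_of_skew.

Lemma Jmap_skewbil_of Z : Jmap skewbil_of Z = \sum_k Z k 0 *: J k.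
Proof.
apply/matrixP => i j; rewrite mxE summxE; apply: eq_bigr => k _.
rewrite !mxE mulrC; congr (_ * _).
rewrite /dotp (bigD1 i) //= big1 => [|l /negPf li]; last first.
  by rewrite [delta_mx i 0 l 0]mxE li mulr0.
by rewrite -colE mxE !mxE !eqxx mulr1 addr0.
Qed.

End FromJ.

Lemma JmapP (R : realType) p q (mu : skewbil R p q) Z X Y :
  dotp (Jmap mu Z *m X) Y = dotp (mu X Y) Z.
Proof.
have dS n (I : finType) (F : I -> R) (e : I -> 'cV[R]_n) v :
    dotp (\sum_i F i *: e i) v = \sum_i F i * dotp (e i) v.
  rewrite /dotp; under [RHS]eq_bigr do rewrite mulr_sumr.
  rewrite exchange_big; apply: eq_bigr => k _ /=.
  by rewrite summxE mulr_suml; apply: eq_bigr => i _; rewrite mxE mulrA.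
transitivity (\sum_i Y i 0 * \sum_j X j 0 * Jmap mu Z i j).
  apply: eq_bigr => i _; rewrite mxE mulrC; congr (_ * _).
  by apply: eq_bigr => j _; rewrite mulrC.
have -> : mu X Y = \sum_i Y i 0 *: mu X (delta_mx i 0).
  rewrite {1}[Y]col_sum_delta linear_sumr.
  by apply: eq_bigr => i _; rewrite linearZr_LR.
rewrite dS; apply: eq_bigr => i _; congr (_ * _).
have -> : mu X (delta_mx i 0) = \sum_j X j 0 *: mu (delta_mx j 0) (delta_mx i 0).
  rewrite {1}[X]col_sum_delta linear_sumlz.
  by apply: eq_bigr => j _; rewrite linearZl_LR.
by rewrite dS; apply: eq_bigr => j _; rewrite mxE.
Qed.

Section Family.
Variable R : realType.

Definition J_mx (t x y z : R) : 'M[R]_8 :=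
  \matrix_(i, j) nth 0 (nth [::]
    [:: [::  0;       0; - x; - y;   0;   0;   0; - z];
        [::  0;       0; t * y; - x; 0;   0; - z;   0];
        [::  x; - (t * y); 0; - x;   0; - z;   0;   0];
        [::  y;       x;   x;   0; - z;   0;   0;   0];
        [::  0;       0;   0;   z;   0;   0; - x; - y];
        [::  0;       0;   z;   0;   0;   0;   y; - x];
        [::  0;       z;   0;   0;   x; - y;   0; - x];
        [::  z;       0;   0;   0;   y;   x;   x;   0]] i) j.

Lemma J_mx_skew t x y z : is_skewmx (J_mx t x y z).
Proof.
apply/matrixP => i j; rewrite !mxE.
by case: i => -[|[|[|[|[|[|[|[|]]]]]]]] // ?;
   case: j => -[|[|[|[|[|[|[|[|]]]]]]]] //= ?; rewrite ?opprK ?oppr0.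
Qed.

Definition mu (t : R) : skewbil R 8 3 :=
  skewbil_of (fun k : 'I_3 =>
    J_mx_skew t (k == 0)%:R (k == 1)%:R (k == 2%:R)%:R).

Lemma Jmap_mu t x y z : Jmap (mu t) (vec3 x y z) = J_mx t x y z.
Proof.
rewrite Jmap_skewbil_of !big_ord_recl big_ord0.
apply/matrixP => i j; rewrite !mxE /=.
by case: i => -[|[|[|[|[|[|[|[|]]]]]]]] // ?;
   case: j => -[|[|[|[|[|[|[|[|]]]]]]]] //= ?; ring.
Qed.

End Family.

(* Main.v *)
(* The Pfaffian form: a polynomial whose square is det is determined up to sign
   along every line through J_0, and the first-row expansion of the Pfaffian
   squares to det by Schur complements, so f_t is read off from the matrix J.

   Non-isomorphism: an isomorphism mu_s -> mu_t induces an invertible matrix M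
   with f_s(M Z) = k f_t(Z), k > 0. The plane mapped to y = 0 is one where f_t
   is a perfect square up to a constant, so it is y = 0, and comparing
   coefficients gives s = t.

   No nilsoliton: let L be the span of X_1, X_2, X_5, X_6; it is abelian, every
   derivation preserves n_2 + L, and has the same trace on (n_2 + L)/n_2 and
   n/(n_2 + L). Summing <Ric e, e> = c + <D e, e> over an orthonormal basis
   adapted to n_2 < n_2 + L < n with weights 0, 1, -1 annihilates the right-hand
   side, while the left-hand side is half the sum of |[e_i, e_j]|^2 over the last
   step. Hence the orthogonal complement of n_2 + L would be abelian, but no
   complement of n_2 + L is. *)
Require Import Defs.
From HB Require Import structures.
From mathcomp Require Import all_boot all_order all_algebra.
From mathcomp Require Import perm sesquilinear boolp classical_sets reals.
From mathcomp Require Import complex ring lra.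
From mathcomp Require mpoly.
Import (canonicals) mpoly.

Set Implicit Arguments.
Unset Strict Implicit.
Unset Printing Implicit Defensive.

Import Order.TTheory GRing.Theory Num.Theory.
Local Open Scope ring_scope.

(** * The Pfaffian of an 8 x 8 skew matrix *)

(** Characteristic zero supplies enough distinct roots: a nonzero difference would vanish at as many
    integers as its size. *)
Lemma poly_horner_ext (R : numDomainType) (p q : {poly R}) :
  (forall x, p.[x] = q.[x]) -> p = q.
Proof.
move=> pq; apply/eqP; rewrite -subr_eq0; apply/negPn/negP => /max_poly_roots.
move=> /(_ [seq i%:R | i <- iota 0 (size (p - q)%R)]).
rewrite size_map size_iota ltnn => H; apply/notF/H.
  by apply/allP => x _; rewrite rootE hornerD hornerN pq subrr.
by rewrite map_inj_uniq ?iota_uniq // => i j /eqP; rewrite eqr_nat => /eqP.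
Qed.

(* Expansion of the Pfaffian of a skew matrix along its first row. *)
Section Pf.
Variables (K : comRingType) (b : nat -> nat -> K).

Definition pf4 i j k l := b i j * b k l - b i k * b j l + b i l * b j k.

Definition pf6 i j k l m n :=
  b i j * pf4 k l m n - b i k * pf4 j l m n + b i l * pf4 j k m n
  - b i m * pf4 j k l n + b i n * pf4 j k l m.

Definition pf8 :=
  b 0 1 * pf6 2 3 4 5 6 7 - b 0 2 * pf6 1 3 4 5 6 7 + b 0 3 * pf6 1 2 4 5 6 7
  - b 0 4 * pf6 1 2 3 5 6 7 + b 0 5 * pf6 1 2 3 4 6 7
  - b 0 6 * pf6 1 2 3 4 5 7 + b 0 7 * pf6 1 2 3 4 5 6.

End Pf.

Section PfMorphism.
Variables (K L : comRingType) (f : {rmorphism K -> L}).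
Variables (b : nat -> nat -> K) (c : nat -> nat -> L).
Hypothesis fb : forall i j, f (b i j) = c i j.

Lemma rmorph_pf4 i j k l : f (pf4 b i j k l) = pf4 c i j k l.
Proof. by rewrite rmorphD rmorphB !rmorphM !fb. Qed.

Lemma rmorph_pf6 i j k l m n : f (pf6 b i j k l m n) = pf6 c i j k l m n.
Proof.
by rewrite rmorphD rmorphB rmorphD rmorphB !rmorphM !rmorph_pf4 !fb.
Qed.

(** Serves for evaluation morphisms, both [horner_eval] on a line of matrices and [mpoly.meval] on
    generic entries. *)
Lemma rmorph_pf8 : f (pf8 b) = pf8 c.
Proof.
rewrite rmorphD rmorphB rmorphD rmorphB rmorphD rmorphB !rmorphM.
by rewrite !rmorph_pf6 !fb.
Qed.

End PfMorphism.

(** Multiplying on the right by a unipotent block matrix clears [C] and leaves the Schur complement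
    of [A]. *)
Lemma det_block_schur (F : fieldType) m n (A : 'M[F]_m) (C : 'M_(m, n))
    (D : 'M_(n, m)) (E : 'M_n) : A \in unitmx ->
  \det (block_mx A C D E) = \det A * \det (E - D *m invmx A *m C).
Proof.
move=> uA; have := det_mulmx (block_mx A C D E)
  (block_mx 1%:M (- (invmx A *m C)) 0 1%:M).
rewrite det_ublock !det1 !mulr1 => <-; rewrite mulmx_block.
rewrite !mulmx1 !mulmx0 !mulmxN mulKVmx // addNr !addr0 det_lblock.
by rewrite mulmxA addrC.
Qed.

Section SchurPf.
Variable F : fieldType.
Implicit Type b : nat -> nat -> F.

Definition skewf b := forall i j, b i j = - b j i.
Definition alternf b := forall i, b i i = 0.

(** The Schur complement of the leading 2 x 2 block, reindexed from 0. Indexing by natural numbers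
    lets it be iterated without casts between matrix sizes. *)
Definition schur b i j := b i.+2 j.+2 - (b 0 i.+2 * b 1 j.+2 - b 1 i.+2 * b 0 j.+2) / b 0 1.

Lemma schur_skew b : skewf b -> skewf (schur b).
Proof. by move=> h i j; rewrite /schur (h i.+2); ring. Qed.

Lemma schur_altern b : alternf b -> alternf (schur b).
Proof. by move=> h i; rewrite /schur h; ring. Qed.

Lemma det_schur n b : skewf b -> alternf b -> b 0 1 != 0 ->
  \det (\matrix_(i < n.+2, j < n.+2) b i j) =
  b 0 1 ^+ 2 * \det (\matrix_(i < n, j < n) schur b i j).
Proof.
move=> sb ab b01.
pose A : 'M[F]_2 := \matrix_(i, j) b i j.
(* The leading block is [b 0 1] times a quarter turn, so its inverse is the opposite quarter turn
   divided by [b 0 1]. *)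
pose A' : 'M[F]_2 := \matrix_(i, j) ((((i == 1) && (j == 0))%:R - ((i == 0) && (j == 1))%:R) / b 0 1).
have AA' : A' *m A = 1%:M.
  apply/matrixP => i j; rewrite !mxE !big_ord_recl big_ord0 !mxE /=.
  by case: i j => -[|[|[]]] // ? [[|[|[]]]] //= ?; rewrite ?ab ?(sb 1 0)/=; field.
have [_ uA] := mulmx1_unit AA'.
have A'E : invmx A = A' by rewrite -[RHS]mulmx1 -(mulmxV uA) mulmxA AA' mul1mx.
pose C : 'M[F]_(2, n) := \matrix_(i, j) b i j.+2.
pose D : 'M[F]_(n, 2) := \matrix_(i, j) b i.+2 j.
pose E : 'M[F]_n := \matrix_(i, j) b i.+2 j.+2.
have -> : \det (\matrix_(i < n.+2, j < n.+2) b i j) = \det (block_mx A C D E).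
  congr (\det _); apply/matrixP => i j; rewrite !mxE.
  by case: splitP => k ->; rewrite mxE; case: splitP => l ->; rewrite mxE.
rewrite det_block_schur // A'E; congr (_ * _).
  rewrite (expand_det_row _ 0) !big_ord_recl big_ord0 /cofactor !det_mx11 !mxE /=.
  by rewrite !ab (sb 1 0); ring.
congr (\det _); apply/matrixP => i j; rewrite !mxE !big_ord_recl big_ord0 !mxE.
rewrite !big_ord_recl !big_ord0 !mxE /= /schur (sb i.+2 0) (sb i.+2 1).
by field.
Qed.

Lemma det_pf2 b : skewf b -> alternf b ->
  \det (\matrix_(i < 2, j < 2) b i j) = b 0 1 ^+ 2.
Proof.
move=> sb ab; rewrite (expand_det_row _ 0) !big_ord_recl big_ord0 /cofactor.
by rewrite !det_mx11 !mxE /= !ab (sb 1 0); ring.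
Qed.

(** Pfaffian counterpart of [det_schur]: elimination extracts the pivot once where the determinant
    extracts its square. *)
Lemma pf4_schur b : b 0 1 != 0 -> pf4 b 0 1 2 3 = b 0 1 * schur b 0 1.
Proof. by move=> h; rewrite /pf4 /schur; field. Qed.

Lemma pf6_schur b : b 0 1 != 0 -> pf6 b 0 1 2 3 4 5 = b 0 1 * pf4 (schur b) 0 1 2 3.
Proof. by move=> h; rewrite /pf6 /pf4 /schur; field. Qed.

Lemma pf8_schur b : b 0 1 != 0 -> pf8 b = b 0 1 * pf6 (schur b) 0 1 2 3 4 5.
Proof. by move=> h; rewrite /pf8 /pf6 /pf4 /schur; field. Qed.

(** The hypothesis bears on the leading Pfaffians of sizes 2, 4, 6. They are successive products of
    the pivots, so three eliminations reduce the size from 8 to 2. *)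
Lemma det_pf8_pivot b : skewf b -> alternf b ->
  b 0 1 * pf4 b 0 1 2 3 * pf6 b 0 1 2 3 4 5 != 0 ->
  \det (\matrix_(i < 8, j < 8) b i j) = pf8 b ^+ 2.
Proof.
move=> sb ab; rewrite !mulf_eq0 !negb_or -andbA => /and3P[h0].
have [sb1 ab1] := (schur_skew sb, schur_altern ab).
have [sb2 ab2] := (schur_skew sb1, schur_altern ab1).
have [sb3 ab3] := (schur_skew sb2, schur_altern ab2).
rewrite pf4_schur // mulf_eq0 negb_or => /andP[_ h1].
rewrite pf6_schur // pf4_schur // !mulf_eq0 !negb_or => /and3P[_ _ h2].
do 3 rewrite det_schur //; rewrite det_pf2 // pf8_schur // pf6_schur // pf4_schur //.
by rewrite !exprMn.
Qed.

End SchurPf.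

Section SkewDet.
Variable R : numFieldType.

(** Diagonal 2 x 2 blocks with entries 1 and -1 off the diagonal: a base point where every leading
    Pfaffian is 1. *)
Definition std_skew (K : pzRingType) (i j : nat) : K :=
  ((~~ odd i && (j == i.+1)))%:R - ((~~ odd j && (i == j.+1)))%:R.

Lemma std_skew_skew (K : pzRingType) i j : std_skew K i j = - std_skew K j i.
Proof. by rewrite /std_skew opprB. Qed.

Lemma rmorph_std_skew (K L : pzRingType) (f : {rmorphism K -> L}) i j :
  f (std_skew K i j) = std_skew L i j.
Proof. by rewrite /std_skew rmorphB !rmorph_nat. Qed.

(* Both sides are polynomial along the line from [std_skew] to [b], and they
   agree where the pivots of the elimination do not vanish. *)
Lemma det_skew_pf8 (b : nat -> nat -> R) : skewf b ->
  \det (\matrix_(i < 8, j < 8) b i j) = pf8 b ^+ 2.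
Proof.
move=> sb.
pose c i j : {poly R} := std_skew _ i j + 'X * (b i j - std_skew R i j)%:P.
pose d s i j := std_skew R i j + s * (b i j - std_skew R i j).
have ev s i j : horner_eval s (c i j) = d s i j.
  by rewrite rmorphD rmorphM rmorph_std_skew /= !horner_evalE hornerX hornerC.
have sd s : skewf (d s).
  by move=> i j; rewrite /d (sb i j) (std_skew_skew _ i j); ring.
have ad s : alternf (d s).
  move=> i; have /eqP := sd s i i.
  by rewrite -addr_eq0 -mulr2n mulrn_eq0 => /eqP.
pose P := c 0 1 * pf4 c 0 1 2 3 * pf6 c 0 1 2 3 4 5.
have P0 : P != 0.
  apply/eqP => /(congr1 (horner_eval 0)); rewrite rmorph0 !rmorphM /= ev.
  rewrite (rmorph_pf4 (ev 0)) (rmorph_pf6 (ev 0)) => /eqP; apply/negP.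
  rewrite /pf6 /pf4 /d /std_skew /=.
  by rewrite !(mul0r, addr0, subr0, add0r, mulr0, mulr1, sub0r, oppr0) oner_eq0.
have ev1 i j : horner_eval 1 (c i j) = b i j.
  by rewrite ev /d mul1r addrC subrK.
suff /(mulfI P0) /(congr1 (horner_eval 1)) :
    P * \det (\matrix_(i < 8, j < 8) c i j) = P * pf8 c ^+ 2.
  rewrite -det_map_mx rmorphXn (rmorph_pf8 ev1) => <-.
  by congr (\det _); apply/matrixP => i j; rewrite !mxE -ev1.
apply: poly_horner_ext => s; rewrite -!/(horner_eval s _) !rmorphM /=.
rewrite ev (rmorph_pf4 (ev s)) (rmorph_pf6 (ev s)).
have [->|nz] := eqVneq (d s 0 1 * pf4 (d s) 0 1 2 3 * pf6 (d s) 0 1 2 3 4 5) 0.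
  by rewrite !mul0r.
congr (_ * _); rewrite -det_map_mx (rmorph_pf8 (ev s)) -expr2 -det_pf8_pivot //.
by congr (\det _); apply/matrixP => i j; rewrite !mxE -ev.
Qed.

End SkewDet.

(** * The normalized Pfaffian of real 8 x 8 skew matrices *)

Section Pfaffian8.
Variable R : realType.

Definition mx_entries n (B : 'M[R]_n.+1) (i j : nat) : R := B (inord i) (inord j).

Lemma skewmxE n (B : 'M[R]_n) i j : is_skewmx B -> B i j = - B j i.
Proof. by move=> /matrixP/(_ j i); rewrite !mxE. Qed.

Lemma det_skewmx_pf8 (B : 'M[R]_8) : is_skewmx B -> \det B = pf8 (mx_entries B) ^+ 2.
Proof.
move=> sB; rewrite -det_skew_pf8; last by move=> i j; exact: skewmxE.
by congr (\det _); apply/matrixP => i j; rewrite mxE /mx_entries !inord_val.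
Qed.

Lemma polynomial_pf8 (a : R) : polynomial_on_so (fun B : 'M[R]_8 => a * pf8 (mx_entries B)).
Proof.
pose x i j := mpoly.mpolyX R (mpoly.mnm1 (@mxvec_index 8 8 (inord i) (inord j))).
exists (a *: pf8 x) => B _; rewrite linearZ /=; congr (_ * _).
apply/esym/rmorph_pf8 => i j; rewrite /mx_entries -(mxvecE B); exact: mpoly.mevalXU.
Qed.

(** Existence of a Pfaffian normalized at [J0]. The factor [pf8 (mx_entries J0)] has square 1 and
    corrects the sign. *)
Lemma is_pfaffian_pf8 (J0 : 'M[R]_8) : is_skewmx J0 -> \det J0 = 1 ->
  is_pfaffian J0 (fun B => pf8 (mx_entries J0) * pf8 (mx_entries B)).
Proof.
move=> sJ dJ; split; first exact: polynomial_pf8.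
  by move=> B sB; rewrite exprMn -!det_skewmx_pf8 // dJ mul1r.
by rewrite -expr2 -det_skewmx_pf8.
Qed.

Lemma meval_line n (P : mpoly.mpoly n R) (v w : 'I_n -> R) :
  exists p : {poly R}, forall s, p.[s] = mpoly.meval (fun k => v k + s * w k) P.
Proof.
pose L k : {poly R} := (v k)%:P + 'X * (w k)%:P.
exists (\sum_(m <- mpoly.msupp P)
          (mpoly.mcoeff m P)%:P * \prod_i L i ^+ mpoly.fun_of_multinom m i).
move=> s; rewrite mpoly.mevalE horner_sum; apply: eq_bigr => m _.
rewrite hornerM hornerC horner_prod; congr (_ * _); apply: eq_bigr => i _.
by rewrite horner_exp /L !hornerE.
Qed.

(* A polynomial whose square is that of [q] is [q] or [- q]. *)
Lemma pfaffian_line (J0 J1 : 'M[R]_8) (q : {poly R}) :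
  is_skewmx J0 -> is_skewmx J1 ->
  (forall s, \det (J0 + s *: (J1 - J0)) = q.[s] ^+ 2) -> q.[0] = 1 ->
  pfaffian J0 J1 = q.[1].
Proof.
move=> s0 s1 dq q0.
have dJ : \det J0 = 1 by have := dq 0; rewrite scale0r addr0 q0 expr1n.
have [[P PE] pf2 pfJ] : is_pfaffian J0 (pfaffian J0).
  by apply: xgetPex; eexists; apply: is_pfaffian_pf8.
have [p pE] := meval_line P (fun k => mxvec J0 0 k) (fun k => mxvec (J1 - J0) 0 k).
have sl s : is_skewmx (J0 + s *: (J1 - J0)).
  by apply/matrixP => i j; rewrite !mxE (skewmxE j i s0) (skewmxE j i s1); ring.
have pfE s : p.[s] = pfaffian J0 (J0 + s *: (J1 - J0)).
  rewrite pE PE //; congr (mpoly.meval _ P); apply: funext => k.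
  by case/mxvec_indexP: k => i j; rewrite !mxvecE !mxE.
have : p ^+ 2 = q ^+ 2.
  by apply: poly_horner_ext => s; rewrite !horner_exp pfE pf2.
move=> /eqP; rewrite eqf_sqr => /orP[] /eqP pq.
  by have := pfE 1; rewrite pq scale1r addrC subrK => <-.
(* The sign -1 is excluded at [s = 0], where both polynomials take the value 1. *)
have := pfE 0; rewrite pq scale0r addr0 pfJ hornerN q0 => /eqP.
by rewrite eq_sym -addr_eq0 -mulr2n pnatr_eq0.
Qed.

Definition pf_form (t x y z : R) :=
  (x ^+ 2 + y ^+ 2 + z ^+ 2) * (x ^+ 2 + t * y ^+ 2 + z ^+ 2).

Lemma pf8_J_mx (t x y z : R) : pf8 (mx_entries (J_mx t x y z)) = pf_form t x y z.
Proof.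
rewrite /pf8 /pf6 /pf4 /mx_entries !mxE !inordK //=.
rewrite /pf_form; ring.
Qed.

End Pfaffian8.

(** * The Pfaffian form of the family *)

Section PfaffianForm.
Variable R : realType.
Implicit Types t x y z : R.

Lemma det_J_mx t x y z : \det (J_mx t x y z) = pf_form t x y z ^+ 2.
Proof. by rewrite det_skewmx_pf8 ?pf8_J_mx //; exact: J_mx_skew. Qed.

Lemma pf_form_gt0 t x y z : 1 < t -> [|| x != 0, y != 0 | z != 0] ->
  0 < pf_form t x y z.
Proof.
move=> t1 h; have x0 := sqr_ge0 x; have y0 := sqr_ge0 y; have z0 := sqr_ge0 z.
have p : 0 < x ^+ 2 + y ^+ 2 + z ^+ 2.
  by case/or3P: h; rewrite -sqrf_eq0 => h; rewrite lt_def ?addr_ge0 // andbT;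
    rewrite !paddr_eq0 ?addr_ge0 // !negb_and h ?orbT.
have ty : 0 <= (t - 1) * y ^+ 2 by rewrite mulr_ge0 // subr_ge0 ltW.
by rewrite /pf_form mulr_gt0 //; apply: lt_le_trans p _; lra.
Qed.

Lemma pf_form_ge0 t x y z : 1 < t -> 0 <= pf_form t x y z.
Proof.
move=> t1; have t0 : 0 <= t by rewrite ltW // (lt_trans ltr01).
by apply: mulr_ge0; do 2 ?apply: addr_ge0; rewrite ?sqr_ge0 // mulr_ge0 ?sqr_ge0.
Qed.

Lemma vec3E (Z : 'cV[R]_3) : Z = vec3 (Z 0 0) (Z 1 0) (Z 2%:R 0).
Proof.
rewrite {1}(col_sum_delta Z) !big_ord_recl big_ord0 addr0 /vec3 addrA.
by congr (_ *: delta_mx _ _ + _ *: delta_mx _ _ + _ *: delta_mx _ _);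
  do ?congr (Z _ _); apply: val_inj.
Qed.

Lemma mu_nonsingular t : 1 < t -> nonsingular (mu t).
Proof.
move=> t1 Z Z0; rewrite (vec3E Z) Jmap_mu unitmxE det_J_mx unitfE.
rewrite sqrf_eq0 gt_eqF // pf_form_gt0 //; apply: contraNT Z0.
rewrite !negb_or !negbK => /and3P[/eqP zx /eqP zy /eqP zz].
by rewrite (vec3E Z) zx zy zz /vec3 !scale0r !addr0.
Qed.

(** The parameter only multiplies [y], so [J_mx 1 0 0 1] is also the value of the [t]-family at Z_3,
    and the line from it stays in that family. *)
Lemma J_mx_line t x y z s :
  J_mx 1 0 0 1 + s *: (J_mx t x y z - J_mx 1 0 0 1) =
  J_mx t (s * x) (s * y) (1 + s * (z - 1)).
Proof.
apply/matrixP => i j; rewrite !mxE.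
by case: i => -[|[|[|[|[|[|[|[|]]]]]]]] // ?;
   case: j => -[|[|[|[|[|[|[|[|]]]]]]]] //= ?; ring.
Qed.

Lemma pfaffian_form_mu t x y z :
  pfaffian_form (J_mx 1 0 0 1) (mu t) x y z = pf_form t x y z.
Proof.
pose q : {poly R} := (('X * x%:P) ^+ 2 + ('X * y%:P) ^+ 2 + (1 + 'X * (z - 1)%:P) ^+ 2) *
  (('X * x%:P) ^+ 2 + t%:P * ('X * y%:P) ^+ 2 + (1 + 'X * (z - 1)%:P) ^+ 2).
have qE s : q.[s] = pf_form t (s * x) (s * y) (1 + s * (z - 1)).
  by rewrite /q /pf_form !(hornerE, horner_exp).
rewrite /pfaffian_form Jmap_mu (pfaffian_line (q := q)).
- by rewrite qE !mul1r addrC subrK.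
- exact: J_mx_skew.
- exact: J_mx_skew.
- by move=> s; rewrite J_mx_line det_J_mx qE.
- by rewrite qE /pf_form !mul0r; ring.
Qed.

(** The matrix squares to minus the identity, so each eigenvalue squares to -1. *)
Lemma J_mx_std_eigenvalues : only_pm_i_eigenvalues (J_mx (1 : R) 0 0 1).
Proof.
move=> a /eigenvalueP [v va v0].
have JJ : J_mx (1 : R) 0 0 1 *m J_mx 1 0 0 1 = - 1%:M.
  apply/matrixP => i j; rewrite !mxE !big_ord_recl big_ord0 !mxE /=.
  by case: i => -[|[|[|[|[|[|[|[|]]]]]]]] // ?;
    case: j => -[|[|[|[|[|[|[|[|]]]]]]]] //= ?; ring.
have := congr1 (mulmxr (map_mx (real_complex R) (J_mx 1 0 0 1))) va.
rewrite /= -mulmxA -map_mxM JJ map_mxN map_mx1 mulmxN mulmx1 -scalemxAl va scalerA.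
move=> /eqP; rewrite eq_sym -addr_eq0 -[X in _ + X]scale1r -scalerDl scaler_eq0.
rewrite (negPf v0) orbF addr_eq0 -sqr_i eqf_sqr.
by case/orP => /eqP ->; [left | right].
Qed.

End PfaffianForm.

(** * Equivalence of the Pfaffian forms *)

(** Five pairwise non-proportional points determine a binary quartic. *)
Lemma quartic_form_eq0 (R : realFieldType) (c0 c1 c2 c3 c4 : R) :
  (forall a b, c0 * a ^+ 4 + c1 * (a ^+ 3 * b) + c2 * (a ^+ 2 * b ^+ 2)
     + c3 * (a * b ^+ 3) + c4 * b ^+ 4 = 0) ->
  [/\ c0 = 0, c1 = 0, c2 = 0, c3 = 0 & c4 = 0].
Proof.
move=> H; have e1 := H 1 0; have e2 := H 0 1; have e3 := H 1 1.
by have e4 := H 1 (-1); have e5 := H 2 1; split; lra.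
Qed.

Section FormEquivalence.
Variables (R : realType) (s t k : R).
Hypotheses (s1 : 1 < s) (t1 : 1 < t) (k0 : 0 < k).
Variables a0 a1 a2 l0 l1 l2 c0 c1 c2 : R.
Hypothesis H : forall x y z,
  pf_form s (a0 * x + a1 * y + a2 * z) (l0 * x + l1 * y + l2 * z)
            (c0 * x + c1 * y + c2 * z) = k * pf_form t x y z.

(* On the plane where the second coordinate of the image vanishes the form is a
   perfect square, which forces this plane to be [y = 0]. *)
Lemma pf_form_equiv_plane : (l0 = 0) /\ (l2 = 0).
Proof.
set n := l0 ^+ 2 + l2 ^+ 2.
have [n0|n0] := eqVneq n 0.
  move/eqP: n0; rewrite /n paddr_eq0 ?sqr_ge0 // !sqrf_eq0.
  by case/andP => /eqP -> /eqP ->.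
exfalso.
(* The plane is spanned by the orthogonal vectors (l2, 0, -l0) and (-l0 l1, n, -l1 l2). The [p]'s
   and [q]'s are the first and third coordinates of their images; [be] is the squared length of the
   second vector, and [ga] its value under x^2 + t y^2 + z^2. *)
pose p0 := a0 * l2 - a2 * l0; pose p2 := c0 * l2 - c2 * l0.
pose q0 := - a0 * l0 * l1 + a1 * n - a2 * l1 * l2.
pose q2 := - c0 * l0 * l1 + c1 * n - c2 * l1 * l2.
pose A := p0 ^+ 2 + p2 ^+ 2; pose B := 2 * (p0 * q0 + p2 * q2).
pose C := q0 ^+ 2 + q2 ^+ 2.
pose be := n * (l1 ^+ 2 + n); pose ga := be + (t - 1) * n ^+ 2.
(* On the plane the hypothesis reads (A a^2 + B a b + C b^2)^2 = k (n a^2 + be b^2) (n a^2 + ga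
   b^2). *)
have [e0 e1 e2 _ e4] : [/\ A ^+ 2 - k * n ^+ 2 = 0, 2 * A * B = 0,
    2 * A * C + B ^+ 2 - k * n * (be + ga) = 0, 2 * B * C = 0 &
    C ^+ 2 - k * be * ga = 0].
  apply: quartic_form_eq0 => a b.
  have := H (l2 * a - l0 * l1 * b) (n * b) (- l0 * a - l1 * l2 * b).
  rewrite /pf_form.
  have -> : l0 * (l2 * a - l0 * l1 * b) + l1 * (n * b) + l2 * (- l0 * a - l1 * l2 * b) = 0.
    by rewrite /n; ring.
  have -> : a0 * (l2 * a - l0 * l1 * b) + a1 * (n * b) + a2 * (- l0 * a - l1 * l2 * b) =
    p0 * a + q0 * b by rewrite /p0 /q0; ring.
  have -> : c0 * (l2 * a - l0 * l1 * b) + c1 * (n * b) + c2 * (- l0 * a - l1 * l2 * b) =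
    p2 * a + q2 * b by rewrite /p2 /q2; ring.
  have -> : (l2 * a - l0 * l1 * b) ^+ 2 + (n * b) ^+ 2 + (- l0 * a - l1 * l2 * b) ^+ 2 =
    n * a ^+ 2 + be * b ^+ 2 by rewrite /be /n; ring.
  have -> : (l2 * a - l0 * l1 * b) ^+ 2 + t * (n * b) ^+ 2 + (- l0 * a - l1 * l2 * b) ^+ 2 =
    n * a ^+ 2 + ga * b ^+ 2 by rewrite /ga /be /n; ring.
  move=> /eqP; rewrite -subr_eq0 => /eqP <-.
  rewrite /A /B /C. ring.
have A0 : A != 0.
  apply: contraTneq k0 => A0; move: e0; rewrite A0 expr0n sub0r => /eqP.
  by rewrite oppr_eq0 mulf_eq0 expf_eq0 (negPf n0) orbF => /eqP ->; rewrite ltxx.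
have B0 : B = 0.
  by move/eqP: e1; rewrite 2!mulf_eq0 (negPf A0) pnatr_eq0 /= => /eqP.
(* Once [B = 0], the right-hand side is the square of a linear form in a^2 and b^2, so its
   discriminant in these variables vanishes. This forces [be = ga], impossible since they differ by
   (t - 1) n^2. *)
have : k ^+ 2 * n ^+ 2 * (be - ga) ^+ 2 = 0.
  have -> : k ^+ 2 * n ^+ 2 * (be - ga) ^+ 2 =
    (k * n * (be + ga)) ^+ 2 - 4 * (k * n ^+ 2) * (k * be * ga) by ring.
  have -> : k * n * (be + ga) = 2 * A * C by move: e2; rewrite B0; lra.
  have -> : k * n ^+ 2 = A ^+ 2 by lra.
  by have -> : k * be * ga = C ^+ 2 by [lra]; ring.
move=> /eqP; rewrite 2!mulf_eq0 !expf_eq0 /= (gt_eqF k0) (negPf n0) /=.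
rewrite /ga opprD addNKr oppr_eq0 mulf_eq0 expf_eq0 /= (negPf n0) orbF.
by rewrite subr_eq0 gt_eqF.
Qed.

(** The [m]'s are the inner products of the columns of the first and third image coordinates.
    Restriction to the three coordinate planes makes the columns orthogonal, with [m00] and [m22]
    nonzero; the y-coefficients then determine [lam] up to two cases. *)
Lemma pf_form_equiv : s = t.
Proof.
have [l00 l20] := pf_form_equiv_plane.
have H' x y z : pf_form s (a0 * x + a1 * y + a2 * z) (l1 * y)
            (c0 * x + c1 * y + c2 * z) = k * pf_form t x y z.
  by rewrite -H l00 l20 !mul0r add0r addr0.
pose m00 := a0 ^+ 2 + c0 ^+ 2; pose m11 := a1 ^+ 2 + c1 ^+ 2.
pose m22 := a2 ^+ 2 + c2 ^+ 2; pose m01 := a0 * a1 + c0 * c1.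
pose m02 := a0 * a2 + c0 * c2; pose m12 := a1 * a2 + c1 * c2.
pose lam := l1 ^+ 2.
have [e0 e1 e2 _ e4] : [/\ m00 ^+ 2 - k = 0, 4 * m00 * m02 = 0,
    2 * m00 * m22 + 4 * m02 ^+ 2 - 2 * k = 0, 4 * m02 * m22 = 0 & m22 ^+ 2 - k = 0].
  apply: quartic_form_eq0 => a b; have /eqP := H' a 0 b.
  by rewrite -subr_eq0 => /eqP <-; rewrite /pf_form /m00 /m02 /m22; ring.
have [_ f1 f2 _ f4] : [/\ m00 ^+ 2 - k = 0, 4 * m00 * m01 = 0,
    m00 * (2 * m11 + (1 + s) * lam) + 4 * m01 ^+ 2 - k * (1 + t) = 0,
    2 * m01 * (2 * m11 + (1 + s) * lam) = 0 &
    (m11 + lam) * (m11 + s * lam) - k * t = 0].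
  apply: quartic_form_eq0 => a b; have /eqP := H' a b 0.
  by rewrite -subr_eq0 => /eqP <-; rewrite /pf_form /m00 /m01 /m11 /lam; ring.
have [_ g1 _ _ _] : [/\ m22 ^+ 2 - k = 0, 4 * m22 * m12 = 0,
    m22 * (2 * m11 + (1 + s) * lam) + 4 * m12 ^+ 2 - k * (1 + t) = 0,
    2 * m12 * (2 * m11 + (1 + s) * lam) = 0 &
    (m11 + lam) * (m11 + s * lam) - k * t = 0].
  apply: quartic_form_eq0 => a b; have /eqP := H' 0 b a.
  by rewrite -subr_eq0 => /eqP <-; rewrite /pf_form /m22 /m12 /m11 /lam; ring.
have p0 : m00 != 0 by apply: contraTneq k0 => h; move: e0; rewrite h -leNgt; lra.
have p2 : m22 != 0 by apply: contraTneq k0 => h; move: e4; rewrite h -leNgt; lra.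
have h02 : m02 = 0 by move/eqP: e1; rewrite !mulf_eq0 (negPf p0) pnatr_eq0 /= => /eqP.
have h01 : m01 = 0 by move/eqP: f1; rewrite !mulf_eq0 (negPf p0) pnatr_eq0 /= => /eqP.
have h12 : m12 = 0 by move/eqP: g1; rewrite !mulf_eq0 (negPf p2) pnatr_eq0 /= => /eqP.
(* Gram determinant of three vectors of the plane *)
have h11 : m11 = 0.
  have : m00 * m22 * m11 = 0.
    transitivity (m00 * m12 ^+ 2 + m22 * m01 ^+ 2 + m11 * m02 ^+ 2 - 2 * m01 * m02 * m12).
      by rewrite /m00 /m22 /m11 /m12 /m01 /m02; ring.
    by rewrite h01 h02 h12; ring.
  by move=> /eqP; rewrite !mulf_eq0 (negPf p0) (negPf p2) /= => /eqP.
have kE : m00 ^+ 2 = k by lra.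
have q2 : (1 + s) * lam = m00 * (1 + t).
  by apply: (mulfI p0); move: f2; rewrite h11 h01 -kE; lra.
have q4 : s * lam ^+ 2 = m00 ^+ 2 * t by move: f4; rewrite h11 kE; lra.
(* By [q2] and [q4], [lam] is a root of X^2 - m00 (1 + t) X + m00^2 t. The root [m00] gives [s = t];
   the root [t * m00] gives s t = 1, contrary to [s1] and [t1]. *)
have : (lam - m00) * (lam - t * m00) = 0.
  by rewrite (_ : _ * _ = lam ^+ 2 - (m00 * (1 + t)) * lam + m00 ^+ 2 * t); 
    [rewrite -q2 -q4|]; ring.
move=> /eqP; rewrite mulf_eq0 !subr_eq0 => /orP[] /eqP le.
  by move: q2; rewrite le mulrC => /(mulfI p0); lra.
have h : s * t + t = 1 + t by apply: (mulfI p0); rewrite -q2 le; ring.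
by have := mulr_egt1 s1 t1; rewrite (addIr t h) ltxx.
Qed.

End FormEquivalence.

(** * From Lie algebra isomorphisms to equivalences of Pfaffian forms *)

Section Isomorphisms.
Variable R : realType.

Lemma dotpE n (u v : 'cV[R]_n) : dotp u v = (u^T *m v) 0 0.
Proof. by rewrite mxE; apply: eq_bigr => i _; rewrite mxE. Qed.

Lemma dotp_delta n (u : 'cV[R]_n) i : dotp u (delta_mx i 0) = u i 0.
Proof. by rewrite dotpE -colE !mxE. Qed.

Lemma mu_delta (t : R) i j k :
  mu t (delta_mx j 0) (delta_mx i 0) k 0 =
  J_mx t (k == 0)%:R (k == 1)%:R (k == 2%:R)%:R i j.
Proof. by rewrite [LHS]mxE dotp_delta -colE mxE. Qed.

(** Bracketing X_1 with X_3, X_4, X_8 yields Z_1, Z_2, Z_3. Hence n_2 is the derived algebra,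
    preserved by isomorphisms and derivations. *)
Lemma mu_delta_surj (t : R) (k : 'I_3) : exists X Y, mu t X Y = delta_mx k 0.
Proof.
exists (delta_mx 0 0), (delta_mx (nth 0 [:: 2%:R; 3%:R; 7%:R] k) 0).
apply/colP => l; rewrite [LHS]mu_delta !mxE.
by case: k l => -[|[|[|]]] // ? [[|[|[|]]]].
Qed.

Definition linear_mx n (f : 'cV[R]_n -> 'cV[R]_n) : 'M[R]_n :=
  \matrix_(i, j) f (delta_mx j 0) i 0.

Lemma linear_mxE n (f : {linear 'cV[R]_n -> 'cV[R]_n}) u : f u = linear_mx f *m u.
Proof.
rewrite {1}[u]col_sum_delta linear_sum; apply/colP => i.
rewrite summxE mxE; apply: eq_bigr => j _; rewrite linearZ !mxE; exact: mulrC.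
Qed.

(** Pair the hypothesis with [Z] and move [C] across the inner product. Determinants of both sides
    then compare the squared Pfaffian forms. *)
Lemma Jmap_pullback p q (mu1 mu2 : skewbil R p q) (A : 'M_p) (C : 'M_q) Z :
  (forall X Y, C *m mu1 X Y = mu2 (A *m X) (A *m Y)) ->
  Jmap mu1 (C^T *m Z) = A^T *m Jmap mu2 Z *m A.
Proof.
move=> AC; apply/matrixP => i j.
rewrite mxE dotpE mulmxA -trmx_mul AC -dotpE -JmapP.
have -> (u v : 'cV[R]_p) : dotp u v = (v^T *m u) 0 0.
  by rewrite -dotpE; apply: eq_bigr => l _; rewrite mulrC.
rewrite trmx_mul trmx_delta !mulmxA. 
by rewrite -colE [LHS]mxE -!mulmxA -rowE [LHS]mxE.
Qed.

Lemma mu_not_isomorphic (s t : R) : 1 < s -> 1 < t -> s <> t ->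
  ~ lie_isomorphic (bracket (mu s)) (bracket (mu t)).
Proof.
move=> s1 t1 st [phi [bij_phi hphi]]; apply: st.
pose F : 'M[R]_(8 + 3) := linear_mx phi.
pose A := ulsubmx F; pose B := ursubmx F; pose C := drsubmx F.
have F0 Z : phi (col_mx 0 Z) = col_mx (B *m Z) (C *m Z).
  by rewrite linear_mxE -/F -[F]submxK mul_block_col !mulmx0 !add0r.
have FX X : usubmx (phi (col_mx X 0)) = A *m X.
  by rewrite linear_mxE -/F -[F]submxK mul_block_col !mulmx0 !addr0 col_mxKu.
have Fmu X Y : col_mx (B *m mu s X Y) (C *m mu s X Y) =
    col_mx 0 (mu t (A *m X) (A *m Y)).
  by rewrite -F0 -!FX; have := hphi (col_mx X 0) (col_mx Y 0);
    rewrite /bracket !col_mxKu.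
have B0 : B = 0.
  apply/matrixP => i k; have [X [Y XY]] := mu_delta_surj s k.
  have /eq_col_mx[+ _] := Fmu X Y; rewrite XY -colE => /colP/(_ i).
  by rewrite !mxE.
have Cmu X Y : C *m mu s X Y = mu t (A *m X) (A *m Y).
  by have /eq_col_mx[_ ->] := Fmu X Y.
have Cu : C^T \in unitmx.
  rewrite unitmx_tr -unitmx_tr -row_free_unit -kermx_eq0; apply/rowV0P => u /sub_kermxP uC.
  apply: trmx_inj; rewrite trmx0.
  have : phi (col_mx 0 u^T) = phi 0.
    by rewrite F0 B0 mul0mx -[C]trmxK -trmx_mul uC trmx0 col_mx0 linear0.
  by move/(bij_inj bij_phi); rewrite -[RHS]col_mx0 => /eq_col_mx[].
pose M := C^T.
(* Determinants give equal squares, f_s(M Z)^2 = (det A)^2 f_t(Z)^2. Both forms are nonnegative, so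
   the square root produces the factor |det A|. *)
pose k := `|\det A|.
have H x y z : pf_form s (M 0 0 * x + M 0 1 * y + M 0 2%:R * z)
    (M 1 0 * x + M 1 1 * y + M 1 2%:R * z)
    (M 2%:R 0 * x + M 2%:R 1 * y + M 2%:R 2%:R * z) = k * pf_form t x y z.
  have := congr1 determinant (Jmap_pullback (vec3 x y z) Cmu).
  rewrite [C^T *m _]vec3E -/M !Jmap_mu !det_mulmx det_tr !det_J_mx.
  have ME i : (M *m vec3 x y z) i 0 = M i 0 * x + M i 1 * y + M i 2%:R * z.
    by rewrite /vec3 !mulmxDr -!scalemxAr -!colE !mxE; ring.
  rewrite !ME mulrAC -expr2 -(real_normK (num_real (\det A))) -exprMn => /eqP.
  have kf : 0 <= k * pf_form t x y z by apply: mulr_ge0; [exact: normr_ge0 | exact: pf_form_ge0].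
  by rewrite eqrXn2 // ?pf_form_ge0 // => /eqP.
(* Otherwise f_s would vanish at the first column of the invertible matrix [M], which is nonzero. *)
have k0 : 0 < k.
  rewrite lt_def normr_ge0 andbT; apply/eqP => k0.
  have := H 1 0 0; rewrite k0 mul0r => /eqP; apply/negP; rewrite gt_eqF //.
  apply: pf_form_gt0 => //; rewrite !mulr1 !mulr0 !addr0; apply/negPn/negP.
  rewrite !negb_or !negbK => /and3P[/eqP h0 /eqP h1 /eqP h2].
  have : col 0 M = 0.
    by rewrite [LHS]vec3E ![col 0 M _ _]mxE h0 h1 h2 /vec3 !scale0r !addr0.
  rewrite colE => /(congr1 (mulmx (invmx M))); rewrite mulKmx // mulmx0.
  by move=> /colP/(_ 0)/eqP; rewrite !mxE oner_eq0.
exact (pf_form_equiv s1 t1 k0 H).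
Qed.

End Isomorphisms.

(** * Ricci curvature of two-step nilpotent metrics *)

Section RicciTwoStep.
Variables (R : realType) (n : nat).
Local Notation V := 'cV[R]_n.
Variables (g : {dot V for idfun}) (br : {bilinear V -> V -> V}).

Local Notation nabla := (levi_civita br g).

Lemma br_linearl a x y u : br (a *: x + y) u = a *: br x u + br y u.
Proof. by rewrite linearDl linearZl_LR. Qed.

Lemma br_linearr a x y u : br u (a *: x + y) = a *: br u x + br u y.
Proof. by rewrite linearDr linearZr_LR. Qed.

Lemma levi_civita_linearr u a v w : nabla u (a *: v + w) = a *: nabla u v + nabla u w.
Proof.
apply: (@dot_inj _ _ g) => x; rewrite dot_linearl !levi_civitaP.
by rewrite br_linearl br_linearr !(dot_linearl, dot_linearr); ring.
Qed.

Lemma levi_civita_linearl u a v w : nabla (a *: v + w) u = a *: nabla v u + nabla w u.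
Proof.
apply: (@dot_inj _ _ g) => x; rewrite dot_linearl !levi_civitaP.
by rewrite br_linearl br_linearr !(dot_linearl, dot_linearr); ring.
Qed.

Lemma riemann_linearl u v : linear (fun w => riemann br g w u v).
Proof.
move=> a x y; rewrite /riemann br_linearl !levi_civita_linearl levi_civita_linearr.
by apply/colP => i; rewrite !mxE; ring.
Qed.

Lemma riemann_linearr u w : linear (riemann br g w u).
Proof.
move=> a x y; rewrite /riemann !levi_civita_linearr.
by apply/colP => i; rewrite !mxE; ring.
Qed.

Lemma ricci_linear u : scalar (ricci br g u).
Proof.
move=> a x y; rewrite /ricci /endo_trace mulr_sumr -big_split; apply: eq_bigr => i _.
by rewrite riemann_linearr !mxE.
Qed.

Section OrthonormalBasis.
Variable e : 'I_n -> V.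
Hypothesis e_orthonormal : forall i j, g (e i) (e j) = (i == j)%:R.

Lemma orthonormal_expand x : x = \sum_j g x (e j) *: e j.
Proof.
pose E : 'M[R]_n := \matrix_(i, j) e j i 0.
have Ee j : E *m delta_mx j 0 = e j.
  by rewrite -colE; apply/colP => i; rewrite !mxE.
have Eg y j : (E^T *m gram g *m y) j 0 = g y (e j).
  by rewrite dot_sym gramE -Ee trmx_mul trmx_delta -!mulmxA -rowE [RHS]mxE.
(* Orthonormality makes [E^T *m gram g] a left inverse of the square matrix [E], hence a right
   inverse, which is the expansion formula. *)
have /mulmx1C EE : E^T *m gram g *m E = 1%:M.
  apply/matrixP => i j; have := Eg (e j) i.
  by rewrite e_orthonormal -{1}(Ee j) mulmxA -colE [LHS]mxE => ->; rewrite mxE eq_sym.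
rewrite -[LHS]mul1mx -EE -mulmxA [LHS](col_sum_delta _); apply/colP => i.
rewrite !summxE [LHS](bigD1 i) //= big1 ?addr0 => [|k /negPf ki]; last first.
  by rewrite !mxE eq_sym ki mulr0.
by rewrite !mxE !eqxx mulr1; apply: eq_bigr => j _; rewrite Eg !mxE mulrC.
Qed.

Lemma orthonormal_parseval x y : g x y = \sum_j g x (e j) * g y (e j).
Proof.
rewrite {1}[x]orthonormal_expand dot_suml; apply: eq_bigr => j _.
by rewrite (dot_sym g y).
Qed.

Lemma endo_trace_orthonormal (f : V -> V) : linear f ->
  endo_trace f = \sum_j g (f (e j)) (e j).
Proof.
move=> fl; have f0 : f 0 = 0 by have := fl (-1) 0 0; rewrite scaler0 addr0 scaleN1r addNr.
have fS (F : 'I_n -> R) (b : 'I_n -> V) (s : seq 'I_n) :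
    f (\sum_(i <- s) F i *: b i) = \sum_(i <- s) F i *: f (b i).
  by elim: s => [|i s IH]; rewrite ?big_nil // !big_cons fl IH.
transitivity (\sum_i \sum_j g (f (delta_mx i 0)) (e j) * e j i 0).
  apply: eq_bigr => i _; rewrite {1}[f _]orthonormal_expand summxE.
  by apply: eq_bigr => j _; rewrite mxE.
rewrite exchange_big; apply: eq_bigr => j _ /=.
rewrite [f (e j)](_ : _ = \sum_i e j i 0 *: f (delta_mx i 0)); last first.
  by rewrite {1}[e j]col_sum_delta fS.
rewrite dot_suml; apply: eq_bigr => i _.
by rewrite mulrC.
Qed.

Hypothesis brC : forall u v, br u v = - br v u.
Hypothesis br_central : forall u v w, br (br u v) w = 0.

(* The endomorphism [w |-> nabla w u] is the symmetric part of [w |-> br w u],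
   and [w |-> nabla u w] minus its skew part. *)
Lemma ricci_perp_derived u : (forall x y, g (br x y) u = 0) ->
  ricci br g u u = - 2^-1 * \sum_i g (br (e i) u) (br (e i) u).
Proof.
move=> up; have uu : br u u = 0.
  apply/eqP; have /eqP := brC u u.
  by rewrite -subr_eq0 opprK -mulr2n -scaler_nat scaler_eq0 pnatr_eq0.
have nuu : nabla u u = 0.
  apply: (@dot_inj _ _ g) => x; rewrite levi_civitaP uu linear0l !up; ring.
have nu0 x : nabla x 0 = 0.
  by have := levi_civita_linearr x (-1) 0 0; rewrite scaler0 addr0 scaleN1r addNr.
rewrite /ricci endo_trace_orthonormal; last exact: riemann_linearl.
pose a i j := g (br (e i) u) (e j).
have nE i j : g (nabla (e i) u) (e j) = 2^-1 * (a i j + a j i).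
  by rewrite levi_civitaP up /a (brC u (e j)) linearNl /=; ring.
have nE' i j : g (nabla u (e i)) (e j) = 2^-1 * (a j i - a i j).
  by rewrite levi_civitaP up /a (brC u (e i)) linearNl /=; ring.
(* The sum over [j] pairs the symmetric part with the skew part and is antisymmetric in [i], [j], so
   it cancels when summed over [i]. The last term comes from [nabla (br (e i) u) u]. *)
have rE i : g (riemann br g (e i) u u) (e i) =
    \sum_j 4^-1 * (a j i ^+ 2 - a i j ^+ 2) - 2^-1 * g (br (e i) u) (br (e i) u).
  rewrite /riemann nuu nu0 sub0r linearDl /= !linearNl /=.
  have := levi_civita_metric g brC u (nabla (e i) u) (e i).
  move=> /eqP; rewrite addr_eq0 => /eqP ->; rewrite opprK; congr (_ + _); last first.
    rewrite levi_civitaP (brC u (e i)) !linearNl /= br_central !linear0l /=.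
    rewrite (brC (e i) (br _ _)) br_central oppr0 linear0l; ring.
  rewrite orthonormal_parseval; apply: eq_bigr => j _; rewrite nE nE'.
  by field.
rewrite (eq_bigr _ (fun i _ => rE i)) big_split /= sumrN -mulr_sumr mulNr.
rewrite [X in X - _](_ : _ = 0) ?sub0r //.
under eq_bigr do rewrite -mulr_sumr sumrB.
rewrite -mulr_sumr sumrB [X in _ - X]exchange_big /= subrr mulr0 //.
Qed.

End OrthonormalBasis.
End RicciTwoStep.

(** * Bases adapted to a flag *)

Definition posdefmx (R : numDomainType) n (G : 'M[R]_n) : Prop :=
  G^T = G /\ forall x : 'cV_n, x != 0 -> 0 < (x^T *m G *m x) 0 0.

(** Induction on the size through the Schur complement of the first entry. The last clause says that
    each new basis vector is [G]-orthogonal to the earlier standard vectors. *)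
Lemma cholesky (R : rcfType) n (G : 'M[R]_n) : posdefmx G ->
  exists T : 'M[R]_n,
    [/\ T^T *m G *m T = 1%:M, forall i j : 'I_n, (j < i)%N -> T i j = 0
      & forall i j : 'I_n, (i < j)%N -> (G *m T) i j = 0].
Proof.
elim: n G => [|n IH] G [Gs Gp].
  by exists 1%:M; split=> [|[]|[]] //; rewrite [LHS]flatmx0 [RHS]flatmx0.
pose a : R := G 0 0.
pose c : 'M[R]_(1, n) := ursubmx (G : 'M_(1 + n)).
pose G1 : 'M[R]_n := drsubmx (G : 'M_(1 + n)).
have GE : G = block_mx a%:M c c^T G1 :> 'M_(1 + n).
  rewrite -[LHS](@submxK _ 1 n 1 n); congr block_mx.
    by rewrite [LHS]mx11_scalar; congr (_%:M); rewrite !mxE; congr (G _ _); apply: val_inj.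
  by rewrite /c -{1}Gs; apply/matrixP => i j; rewrite !mxE.
have G1s : G1^T = G1 by apply/matrixP => i j; rewrite !mxE -{1}Gs mxE.
have a0 : 0 < a.
  have := Gp (delta_mx 0 0); rewrite trmx_delta -rowE -colE !mxE; apply.
  by apply/eqP => /colP/(_ 0)/eqP; rewrite !mxE oner_eq0.
pose S := G1 - a^-1 *: (c^T *m c).
have Sp : posdefmx S.
  split=> [|x x0]; first by rewrite linearB linearZ /= trmx_mul trmxK G1s.
  (* The lift of [x] that is [G]-orthogonal to the first standard vector; there [G] takes the value
     of [S] at [x]. *)
  pose y : 'cV[R]_(1 + n) := col_mx (- a^-1 *: (c *m x)) x.
  have y0 : y != 0 by apply: contra x0; rewrite col_mx_eq0 => /andP[].
  have yG : y^T *m block_mx a%:M c c^T G1 = row_mx 0 (x^T *m S).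
    rewrite tr_col_mx mul_row_block; congr row_mx.
      rewrite linearZ /= trmx_mul mul_mx_scalar scalerA mulrN mulfV ?gt_eqF //.
      by rewrite scaleN1r addNr.
    rewrite linearZ /= trmx_mul mulmxBr -scalemxAr scaleNr mulNmx -scalemxAl mulmxA.
    by rewrite addrC.
  have yGy : y^T *m block_mx a%:M c c^T G1 *m y = x^T *m S *m x.
    by rewrite yG mul_row_col mul0mx add0r.
  by have := Gp y y0; rewrite GE yGy.
have [T [TS Tu Tl]] := IH S Sp.
pose r := Num.sqrt a; have r0 : r != 0 by rewrite gt_eqF // sqrtr_gt0.
have rr : r * r = a by rewrite -expr2 sqr_sqrtr // ltW.
pose T1 : 'M[R]_(1 + n) := block_mx r^-1%:M (- a^-1 *: (c *m T)) 0 T.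
have GT : block_mx a%:M c c^T G1 *m T1 = block_mx r%:M 0 (r^-1 *: c^T) (S *m T).
  rewrite mulmx_block !mulmx0 !addr0; congr block_mx.
  - by rewrite -scalar_mxM; congr (_%:M); rewrite -rr mulfK.
  - by rewrite mul_scalar_mx scalerA mulrN mulfV ?gt_eqF // scaleN1r addNr.
  - by rewrite mul_mx_scalar.
  - by rewrite -scalemxAr mulmxA mulmxBl -scalemxAl scaleNr addrC.
have T1G : T1^T *m (block_mx a%:M c c^T G1 *m T1) = 1%:M.
  rewrite GT tr_block_mx mulmx_block [RHS]scalar_mx_block trmx0 !mul0mx !mulmx0 !addr0 add0r.
  rewrite mulmxA TS tr_scalar_mx -scalar_mxM mulVf //; congr block_mx.
  rewrite linearZ /= trmx_mul mul_mx_scalar scalerA -scalemxAr -scalerDl -rr.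
  by rewrite [X in X *: _](_ : _ = 0) ?scale0r //; field.
exists T1; split=> [|i j|i j].
- by rewrite -mulmxA GE T1G.
- have [k ->|k ->] := @split_ordP 1 n i; first by rewrite (ord1 k).
  have [l ->|l ->] := @split_ordP 1 n j; first by rewrite [LHS]block_mxEdl mxE.
  by rewrite [LHS]block_mxEdr; exact: Tu.
rewrite GE GT; have [l ->|l ->] := @split_ordP 1 n j; first by rewrite (ord1 l).
have [k ->|k ->] := @split_ordP 1 n i; first by rewrite [LHS]block_mxEur mxE.
by rewrite [LHS]block_mxEdr; exact: Tl.
Qed.

(* A Gram-Schmidt basis for the order of the standard basis given by [s]; the
   levels of [h] are the steps of the flag to which it is adapted. *)
Lemma adapted_orthonormal_basis (R : realType) n (g : {dot 'cV[R]_n for idfun})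
    (h : 'I_n -> nat) (s : 'S_n) : (forall i j, (h i < h j -> s i < s j)%N) ->
  exists e : 'I_n -> 'cV[R]_n,
    [/\ forall i j, g (e i) (e j) = (i == j)%:R,
        forall i j, (h j < h i)%N -> e j i 0 = 0
      & forall i j, (h i < h j)%N -> g (delta_mx i 0) (e j) = 0].
Proof.
move=> hs; pose P : 'M[R]_n := perm_mx s.
have Pd i : P *m delta_mx (s i) 0 = delta_mx i 0 :> 'cV_n.
  by rewrite -colE; apply/colP => j; rewrite !mxE (inj_eq perm_inj) andbT.
have Gp : posdefmx (P^T *m gram g *m P).
  split=> [|x x0].
    rewrite !trmx_mul trmxK mulmxA; congr (_ *m _ *m _).
    by apply/matrixP => i j; rewrite !mxE dot_sym.
  have := neq0_dnorm_gt0 (s := g) (P *m x); rewrite gramE trmx_mul !mulmxA; apply.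
  apply: contra x0 => /eqP Px; rewrite -[x](mulKmx (unitmx_perm _ s)) -/P Px.
  by rewrite mulmx0.
have [T [TG Tu Tl]] := cholesky Gp.
exists (fun j => P *m T *m delta_mx (s j) 0).
have eE i j : (P *m T *m delta_mx (s j) 0 : 'cV_n) i 0 = T (s i) (s j).
  by rewrite -colE -row_permE !mxE.
split=> i j.
- rewrite gramE; have -> (u v : 'cV_n) : (P *m T *m u)^T *m gram g *m (P *m T *m v) =
      u^T *m (T^T *m (P^T *m gram g *m P) *m T) *m v by rewrite !trmx_mul !mulmxA.
  by rewrite TG mulmx1 trmx_delta -rowE !mxE (inj_eq perm_inj) andbT.
- by move=> /hs; rewrite eE; exact: Tu.
- move=> /hs; rewrite gramE -(Pd i) trmx_mul trmx_delta -!mulmxA -rowE mxE => ij.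
  by rewrite !mulmxA -colE mxE; exact: Tl.
Qed.

(** * Nilsolitons and abelian complements *)

(* [h] stratifies the coordinates: level 0 contains the derived algebra and is
   central, levels 0 and 1 span an abelian ideal, level 2 is the rest. *)
Section NilsolitonFlag.
Variables (R : realType) (n : nat).
Local Notation V := 'cV[R]_n.
Variables (g : {dot V for idfun}) (br : {bilinear V -> V -> V}).
Variables (h : 'I_n -> nat) (s : 'S_n).

Definition flag_weight i : R := (h i == 1%N)%:R - (h i == 2%N)%:R.

Hypothesis brC : forall u v, br u v = - br v u.
Hypothesis h_le2 : forall i, (h i <= 2)%N.
Hypothesis h_sorted : forall i j, (h i < h j -> s i < s j)%N.
Hypothesis br_derived : forall u v i, (0 < h i)%N -> br u v i 0 = 0.
Hypothesis br_center : forall i v, h i = 0%N -> br (delta_mx i 0) v = 0.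
Hypothesis br_abelian : forall i j, h i = 1%N -> h j = 1%N ->
  br (delta_mx i 0) (delta_mx j 0) = 0.
Hypothesis flag_weight_sum : \sum_i flag_weight i = 0.
Hypothesis derivation_flag : forall D : {linear V -> V}, is_derivation br D ->
  forall k l, (h l < h k)%N -> D (delta_mx l 0) k 0 = 0.
Hypothesis derivation_trace : forall D : {linear V -> V}, is_derivation br D ->
  \sum_i flag_weight i * D (delta_mx i 0) i 0 = 0.

Lemma br_suml (F : 'I_n -> R) (b : 'I_n -> V) v :
  br (\sum_i F i *: b i) v = \sum_i F i *: br (b i) v.
Proof. by rewrite linear_sumlz; apply: eq_bigr => i _; rewrite linearZl_LR. Qed.

Lemma br_sumr (F : 'I_n -> R) (b : 'I_n -> V) v :
  br v (\sum_i F i *: b i) = \sum_i F i *: br v (b i).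
Proof. by rewrite linear_sumr; apply: eq_bigr => i _; rewrite linearZr_LR. Qed.

Lemma br_central_level0 (u v : V) : (forall i, (0 < h i)%N -> u i 0 = 0) -> br u v = 0.
Proof.
move=> u0; rewrite [u]col_sum_delta br_suml big1 // => i _.
have [hi|hi] := posnP (h i); first by rewrite br_center // scaler0.
by rewrite u0 // scale0r.
Qed.

Lemma br_br u v w : br (br u v) w = 0.
Proof. by apply: br_central_level0 => i; exact: br_derived. Qed.

Lemma br_abelian_level1 (u v : V) : (forall i, (1 < h i)%N -> u i 0 = 0) ->
  (forall i, (1 < h i)%N -> v i 0 = 0) -> br u v = 0.
Proof.
move=> u1 v1; rewrite [u]col_sum_delta br_suml big1 // => i _.
have [hi|hi] := leqP (h i) 1%N; last by rewrite u1 // scale0r.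
rewrite [v]col_sum_delta br_sumr big1 ?scaler0 // => j _.
have [hj|hj] := leqP (h j) 1%N; last by rewrite v1 // scale0r.
have [hi0|hi0] := posnP (h i); first by rewrite br_center // scaler0.
have [hj0|hj0] := posnP (h j); first by rewrite brC br_center // oppr0 !scaler0.
by rewrite br_abelian ?scaler0 //; apply/eqP; rewrite eqn_leq ?hi ?hj.
Qed.

Section AdaptedBasis.
Variable e : 'I_n -> V.
Hypothesis e_orthonormal : forall i j, g (e i) (e j) = (i == j)%:R.
Hypothesis e_flag : forall i j, (h j < h i)%N -> e j i 0 = 0.
Hypothesis e_perp : forall i j, (h i < h j)%N -> g (delta_mx i 0) (e j) = 0.

Lemma derived_perp x y j : (0 < h j)%N -> g (br x y) (e j) = 0.
Proof.
move=> hj; rewrite [br x y]col_sum_delta dot_suml big1 // => i _.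
have [hi|hi] := posnP (h i); first by rewrite e_perp ?hi // mulr0.
by rewrite br_derived // mul0r.
Qed.

(* The factors force [h l <= h j <= h k <= h l] for a nonzero term. *)
Lemma weighted_trace (D : {linear V -> V}) :
  (forall k l, (h l < h k)%N -> D (delta_mx l 0) k 0 = 0) ->
  \sum_j flag_weight j * g (D (e j)) (e j) =
  \sum_i flag_weight i * D (delta_mx i 0) i 0.
Proof.
move=> Dh; pose U k j := g (delta_mx k 0) (e j).
transitivity (\sum_j \sum_l \sum_k
    flag_weight k * D (delta_mx l 0) k 0 * (U k j * e j l 0)).
  apply: eq_bigr => j _; rewrite {1}[e j]col_sum_delta linear_sum.
  rewrite linear_sumlz mulr_sumr; apply: eq_bigr => l _.
  rewrite linearZ linearZl_LR /= [D _]col_sum_delta dot_suml !mulr_sumr.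
  apply: eq_bigr => k _; rewrite -col_sum_delta -/(U k j).
  have [lk|kl] := ltnP (h l) (h k); first by rewrite Dh //; ring.
  have [jl|lj] := ltnP (h j) (h l); first by rewrite e_flag //; ring.
  have [kj|jk] := ltnP (h k) (h j); first by rewrite /U e_perp //; ring.
  rewrite /flag_weight (_ : h j = h k); first by ring.
  by apply/eqP; rewrite eqn_leq jk (leq_trans kl lj).
rewrite exchange_big; apply: eq_bigr => l _; rewrite exchange_big /= (bigD1 l) //=.
have UE k : \sum_j U k j * e j l 0 = (k == l)%:R.
  have := congr1 (fun x : V => x l 0) (orthonormal_expand e_orthonormal (delta_mx k 0)).
  rewrite summxE mxE eqxx andbT eq_sym => ->.
  by apply: eq_bigr => j _; rewrite mxE.
rewrite -mulr_sumr UE eqxx mulr1 big1 ?addr0 // => k /negPf kl.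
by rewrite -mulr_sumr UE kl mulr0.
Qed.

(** The weighted sum of the Ricci identities gives a vanishing weighted sum of the [q i j].
    Symmetrized in [i], [j], it keeps only the pairs at level 2, with nonnegative terms: level 0 is
    central, level 1 is abelian, and the weights of levels 1 and 2 cancel. *)
Lemma nilsoliton_adapted_br : is_nilsoliton br g ->
  forall i j, h i = 2%N -> h j = 2%N -> br (e i) (e j) = 0.
Proof.
move=> [c [D [derD ricD]]].
pose q i j := g (br (e i) (e j)) (br (e i) (e j)).
have qC i j : q i j = q j i.
  by rewrite /q (brC (e i)) linearNl /= dot_sym linearNl /= opprK.
have ric i : (0 < h i)%N -> c + g (D (e i)) (e i) = - 2^-1 * \sum_j q i j.
  move=> hi; have := rieszP g (e i) (ricci_linear g br (e i)).
  rewrite -/(ricci_op br g (e i)) ricD linearDl linearZl_LR /= e_orthonormal eqxx mulr1 => ->.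
  rewrite (ricci_perp_derived e_orthonormal brC br_br); last first.
    by move=> x y; exact: derived_perp.
  by congr (_ * _); apply: eq_bigr => j _; exact: qC.
have : \sum_i flag_weight i * (c + g (D (e i)) (e i)) = 0.
  under eq_bigr do rewrite mulrDr.
  rewrite big_split /= -mulr_suml flag_weight_sum mul0r add0r weighted_trace.
    exact: derivation_trace.
  exact: derivation_flag.
(* The formula [ric] is only available orthogonally to the derived algebra; at level 0 the weight is
   zero. *)
have -> : \sum_i flag_weight i * (c + g (D (e i)) (e i)) =
    - 2^-1 * \sum_i \sum_j flag_weight i * q i j.
  rewrite mulr_sumr; apply: eq_bigr => i _.
  have [hi|hi] := posnP (h i); last by rewrite ric // mulrCA mulr_sumr.
  by rewrite /flag_weight hi subrr mul0r big1 ?mulr0 // => j _; rewrite mul0r.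
move=> /eqP; rewrite mulf_eq0 oppr_eq0 invr_eq0 pnatr_eq0 /= => /eqP q0.
have qs : \sum_i \sum_j - (flag_weight i + flag_weight j) * q i j = 0.
  transitivity (- (\sum_i \sum_j flag_weight i * q i j + \sum_j \sum_i flag_weight j * q j i)).
    rewrite [X in _ + X]exchange_big -big_split -sumrN; apply: eq_bigr => i _ /=.
    rewrite -big_split -sumrN; apply: eq_bigr => j _ /=; rewrite (qC j i); ring.
  by rewrite q0 addr0 oppr0.
have qE i j : - (flag_weight i + flag_weight j) * q i j =
    (2 * ((h i == 2%N) && (h j == 2%N))%:R) * q i j.
  have q00 k l : h k = 0%N -> q k l = 0.
    move=> hk; rewrite /q br_central_level0 ?linear0l // => m hm.
    by rewrite e_flag ?hk.
  have q11 : h i = 1%N -> h j = 1%N -> q i j = 0.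
    move=> hi hj; rewrite /q br_abelian_level1 ?linear0l // => m hm; rewrite e_flag ?hi ?hj //.
  have [hi|hi] := posnP (h i); first by rewrite q00 // !mulr0.
  have [hj|hj] := posnP (h j); first by rewrite qC q00 // !mulr0.
  have h12 k : (0 < h k)%N -> h k = 1%N \/ h k = 2%N.
    by case: (h k) (h_le2 k) => [|[|[|]]] //; [left | right].
  rewrite /flag_weight; case: (h12 i hi) (h12 j hj) => hi' [] hj'; rewrite hi' hj' /=; try ring.
  by rewrite q11 // !mulr0.
have q_ge0 i j : 0 <= q i j.
  rewrite /q; have [->|] := eqVneq (br (e i) (e j)) 0; first by rewrite linear0l.
  by move=> /(neq0_dnorm_gt0 (s := g))/ltW.
have qp i j : 0 <= - (flag_weight i + flag_weight j) * q i j.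
  by rewrite qE !mulr_ge0.
move=> i j hi hj.
have qi : \sum_j - (flag_weight i + flag_weight j) * q i j = 0.
  by apply: (psumr_eq0P _ qs) => // k _; apply: sumr_ge0 => l _; exact: qp.
have : - (flag_weight i + flag_weight j) * q i j = 0.
  by apply: (psumr_eq0P _ qi) => // k _; exact: qp.
rewrite qE hi hj mulr1 => /eqP; rewrite mulf_eq0 pnatr_eq0 /= => /eqP qij.
apply/eqP/negPn/negP => /(neq0_dnorm_gt0 (s := g)).
by rewrite -/(q i j) qij ltxx.
Qed.

End AdaptedBasis.

(* [f k] is the component of the [k]-th standard vector orthogonal to levels 0 and 1. *)
Lemma nilsoliton_abelian_complement : is_nilsoliton br g ->
  exists f : 'I_n -> V, forall k l, h k = 2%N -> h l = 2%N ->
    f k l 0 = (k == l)%:R /\ br (f k) (f l) = 0.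
Proof.
move=> sol; have [e [eo ef ep]] := adapted_orthonormal_basis g h_sorted.
pose f k : V := \sum_j (h j == 2%N)%:R * g (delta_mx k 0) (e j) *: e j.
exists f => k l hk hl; split.
  have <- : (delta_mx k 0 : V) l 0 = (k == l)%:R by rewrite mxE eqxx andbT eq_sym.
  rewrite [in RHS](orthonormal_expand eo (delta_mx k 0)) !summxE; apply: eq_bigr => j _.
  rewrite !mxE; have [_|hj] := eqVneq; first by rewrite mul1r.
  by rewrite ef ?mulr0 // hl ltn_neqAle hj h_le2.
rewrite /f br_suml big1 // => i _.
have [hi|_] := eqVneq (h i) 2%N; last by rewrite mul0r scale0r.
rewrite br_sumr big1 ?scaler0 // => j _.
have [hj|_] := eqVneq (h j) 2%N; last by rewrite mul0r scale0r.
by rewrite (nilsoliton_adapted_br eo ef ep sol) ?scaler0.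
Qed.

End NilsolitonFlag.

(** * Derivations of the family *)

(** The matrices of J(Z_1), J(Z_2), J(Z_3) as literal lists, so that sums over [iota] reduce by
    computation to polynomials in [t]. *)
Definition J_coef (R : realType) (t : R) (k i j : nat) : R := nth 0 (nth [::] (nth [::] [::
  [:: [:: 0; 0; -1; 0; 0; 0; 0; 0]; [:: 0; 0; 0; -1; 0; 0; 0; 0];
      [:: 1; 0; 0; -1; 0; 0; 0; 0]; [:: 0; 1; 1; 0; 0; 0; 0; 0];
      [:: 0; 0; 0; 0; 0; 0; -1; 0]; [:: 0; 0; 0; 0; 0; 0; 0; -1];
      [:: 0; 0; 0; 0; 1; 0; 0; -1]; [:: 0; 0; 0; 0; 0; 1; 1; 0]];
  [:: [:: 0; 0; 0; -1; 0; 0; 0; 0]; [:: 0; 0; t; 0; 0; 0; 0; 0];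
      [:: 0; - t; 0; 0; 0; 0; 0; 0]; [:: 1; 0; 0; 0; 0; 0; 0; 0];
      [:: 0; 0; 0; 0; 0; 0; 0; -1]; [:: 0; 0; 0; 0; 0; 0; 1; 0];
      [:: 0; 0; 0; 0; 0; -1; 0; 0]; [:: 0; 0; 0; 0; 1; 0; 0; 0]];
  [:: [:: 0; 0; 0; 0; 0; 0; 0; -1]; [:: 0; 0; 0; 0; 0; 0; -1; 0];
      [:: 0; 0; 0; 0; 0; -1; 0; 0]; [:: 0; 0; 0; 0; -1; 0; 0; 0];
      [:: 0; 0; 0; 1; 0; 0; 0; 0]; [:: 0; 0; 1; 0; 0; 0; 0; 0];
      [:: 0; 1; 0; 0; 0; 0; 0; 0]; [:: 1; 0; 0; 0; 0; 0; 0; 0]]] k) i) j.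

Lemma J_mx_coef (R : realType) (t : R) (k : 'I_3) (i j : 'I_8) :
  J_mx t (k == 0)%:R (k == 1)%:R (k == 2%:R)%:R i j = J_coef t k i j.
Proof.
rewrite mxE; case: k => -[|[|[|//]]] ?; rewrite -!val_eqE /= ?mulr0 ?mulr1 ?oppr0;
  case: i => -[|[|[|[|[|[|[|[|//]]]]]]]] ? //=;
  by case: j => -[|[|[|[|[|[|[|[|//]]]]]]]] ?.
Qed.

Section DerivationsMu.
Variables (R : realType) (t : R).
Hypothesis t1 : 1 < t.

Section Relations.
(* [a] and [c] are the matrices of a derivation on the two summands; [rel k i j]
   is the [k]-th coordinate of the derivation identity at [X_j], [X_i]. The
   combinations below were found by solving this linear system over Q(t). *)
Variables a c : nat -> nat -> R.

Let rel k i j := \sum_(l <- iota 0 3) c k l * J_coef t l i j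
  - \sum_(m <- iota 0 8) (a m j * J_coef t k i m + a m i * J_coef t k m j).

Hypothesis rel0 : forall k i j, (k < 3)%N -> (i < 8)%N -> (j < 8)%N -> rel k i j = 0.

Ltac rel_certificate e :=
  transitivity e; [|by rewrite !rel0 //; ring];
  rewrite /rel !big_cons !big_nil; rewrite /J_coef /=; ring.

Lemma derivation_trace_mu :
  a 0 0 + a 1 1 + a 4 4 + a 5 5 - a 2 2 - a 3 3 - a 6 6 - a 7 7 = 0.
Proof.
rel_certificate (- rel 0 0 1 + rel 0 0 2 + rel 0 1 3 - 2 * rel 0 2 3 - rel 0 4 5 + rel
    0 4 6 + rel 0 5 7 - 2 * rel 0 6 7 + 2 * rel 2 2 6 - 2 * rel 2 3 7).
Qed.

(** Each certificate proves the vanishing of the entry times t - 1, t + 1 or 2 t, all nonzero for t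
    > 1. *)
Lemma derivation_flag_mu i j : i \in [:: 2; 3; 6; 7]%N -> j \in [:: 0; 1; 4; 5]%N ->
  a i j = 0.
Proof.
have tm : t - 1 != 0 by rewrite subr_eq0 gt_eqF.
have tp : t + 1 != 0 by rewrite gt_eqF // addr_gt0 // (lt_trans ltr01).
have t2 : 2 * t != 0 by rewrite mulf_neq0 ?pnatr_eq0 // gt_eqF // (lt_trans ltr01).
rewrite !inE => /or4P[] /eqP -> /or4P[] /eqP ->.
- apply: (mulfI tm); rewrite mulr0.
  rel_certificate (rel 1 0 1 + rel 1 4 5 - rel 2 0 5 - rel 2 1 4).
- apply: (mulfI t2); rewrite mulr0.
  rel_certificate (t * rel 0 1 3 - t * rel 0 5 7 + rel 1 1 2 + t * rel 1 4 7 + t * rel 2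
    1 5 + t * rel 2 2 5 - t * rel 2 3 4).
- apply: (mulfI tp); rewrite mulr0.
  rel_certificate (rel 0 1 5 - rel 1 1 4 + rel 2 4 5).
- apply: (mulfI tm); rewrite mulr0.
  rel_certificate (- rel 0 0 5 - rel 0 1 4 + rel 1 0 4 - rel 1 1 5).
- apply: (mulfI t2); rewrite mulr0.
  rel_certificate (- (t * rel 0 0 2) + t * rel 0 4 6 + t * rel 1 0 3 + t * rel 1 5 6 + t
    * rel 2 0 4 + t * rel 2 2 5 - t * rel 2 3 4).
- apply: (mulfI tm); rewrite mulr0.
  rel_certificate (- rel 1 0 1 - t * rel 1 4 5 + t * rel 2 0 5 + t * rel 2 1 4).
- apply: (mulfI tm); rewrite mulr0.
  rel_certificate (- (t * rel 0 0 5) - rel 0 1 4 + t * rel 1 0 4 - rel 1 1 5).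
- apply: (mulfI tp); rewrite mulr0.
  rel_certificate (rel 0 1 5 - rel 1 1 4 - t * rel 2 4 5).
- apply: (mulfI t2); rewrite mulr0.
  rel_certificate (- (t * rel 0 1 5) + t * rel 1 0 5 - t * rel 2 0 1).
- apply: (mulfI tm); rewrite mulr0.
  rel_certificate (- (t * rel 0 0 5) - t * rel 0 1 4 + t * rel 1 0 4 - rel 1 1 5).
- apply: (mulfI tm); rewrite mulr0.
  rel_certificate (rel 1 0 1 + t * rel 1 4 5 - t * rel 2 0 5 - rel 2 1 4).
- apply: (mulfI t2); rewrite mulr0.
  rel_certificate (- (t * rel 0 1 3) + t * rel 0 5 7 - rel 1 1 2 - t * rel 1 4 7 + t *
    rel 2 1 5 - t * rel 2 2 5 + t * rel 2 3 4).
- apply: (mulfI tm); rewrite mulr0.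
  rel_certificate (- (t * rel 0 0 5) - rel 0 1 4 + rel 1 0 4 - rel 1 1 5).
- apply: (mulfI t2); rewrite mulr0.
  rel_certificate (- (t * rel 0 1 5) + t * rel 1 0 5 + t * rel 2 0 1).
- apply: (mulfI t2); rewrite mulr0.
  rel_certificate (t * rel 0 0 2 - t * rel 0 4 6 - t * rel 1 0 3 - t * rel 1 5 6 + t *
    rel 2 0 4 - t * rel 2 2 5 + t * rel 2 3 4).
- apply: (mulfI tm); rewrite mulr0.
  rel_certificate (- rel 1 0 1 - rel 1 4 5 + t * rel 2 0 5 + rel 2 1 4).
Qed.

End Relations.

(* No complement of the ideal spanned by X_1, X_2, X_5, X_6 and the centre is
   abelian: [u p] stands for a vector congruent to X_p modulo this ideal. *)
Lemma bracket_complement_mu (u : nat -> nat -> R) :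
  (forall p i : nat, p \in [:: 2; 3; 6; 7]%N -> i \in [:: 2; 3; 6; 7]%N -> u p i = (p == i)%:R) ->
  let b k p q := \sum_(i <- iota 0 8) \sum_(j <- iota 0 8) J_coef t k i j * u p j * u q i in
  b 0 2 3 + b 0 6 7 - b 2 2 6 + b 2 3 7 = 2.
Proof.
(* Both [X_3, X_4] and [X_7, X_8] have Z_1-coefficient 1, whence the value 2; the unknown components
   in the ideal cancel in this combination. *)
move=> uE b; rewrite /b !big_cons !big_nil /J_coef /=.
rewrite (uE 2 2) // (uE 2 3) // (uE 2 6) // (uE 2 7) // (uE 3 2) // (uE 3 3) //.
rewrite (uE 3 6) // (uE 3 7) // (uE 6 2) // (uE 6 3) // (uE 6 6) // (uE 6 7) //.
rewrite (uE 7 2) // (uE 7 3) // (uE 7 6) // (uE 7 7) //=.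
by ring.
Qed.

End DerivationsMu.

(** * Derivations of a two-step bracket in block form *)

Section BracketBilinear.
Variables (R : realType) (p q : nat) (mu : skewbil R p q).

Lemma bracket_bilinear : bilinear_for *:%R *:%R (bracket mu).
Proof.
split=> [v|u] a x y; rewrite /= /bracket linearD linearZ /= scale_col_mx add_col_mx.
  by rewrite linearDl linearZl_LR scaler0 addr0.
by rewrite linearDr linearZr_LR scaler0 addr0.
Qed.

HB.instance Definition _ :=
  bilinear_isBilinear.Build R _ _ _ *:%R *:%R (bracket mu) bracket_bilinear.

Lemma bracket_skew u v : bracket mu u v = - bracket mu v u.
Proof. by rewrite /bracket skewbilC opp_col_mx oppr0. Qed.

(** The derivation identity on n_1, split along n_1 and n_2. The n_1-part shows that the block from
    n_2 to n_1 kills all brackets. *)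
Lemma derivation_bracket (D : {linear 'cV[R]_(p + q) -> 'cV[R]_(p + q)}) :
  is_derivation (bracket mu) D -> forall X Y,
  drsubmx (linear_mx D) *m mu X Y =
    mu (ulsubmx (linear_mx D) *m X) Y + mu X (ulsubmx (linear_mx D) *m Y) /\
  ursubmx (linear_mx D) *m mu X Y = 0.
Proof.
move=> derD X Y; set M := linear_mx D.
have DX Z : usubmx (D (col_mx Z 0)) = ulsubmx M *m Z.
  by rewrite linear_mxE -/M -[M]submxK mul_block_col !mulmx0 !addr0 col_mxKu block_mxKul.
have := derD (col_mx X 0) (col_mx Y 0).
rewrite /bracket !DX !col_mxKu add_col_mx addr0 linear_mxE -/M -{1}[M]submxK.
by rewrite mul_block_col !mulmx0 !add0r => /eq_col_mx[-> ->].
Qed.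

End BracketBilinear.

(** * The flag of the family and the exclusion of nilsolitons *)

Section NoNilsoliton.
Variables (R : realType) (t : R).
Hypothesis t1 : 1 < t.

Definition level (i : 'I_(8 + 3)) : nat := nth 0%N [:: 1; 1; 2; 2; 1; 1; 2; 2; 0; 0; 0]%N i.

(** Sorts the basis by level: Z_1, Z_2, Z_3, then X_1, X_2, X_5, X_6, then X_3, X_4, X_7, X_8. *)
Definition level_rank (i : 'I_(8 + 3)) : 'I_(8 + 3) :=
  @inord 10 (nth 0%N [:: 3; 4; 7; 8; 5; 6; 9; 10; 0; 1; 2]%N i).

Lemma level_rank_inj : injective level_rank.
Proof.
apply: (can_inj (g := fun i : 'I_(8 + 3) =>
  @inord 10 (nth 0%N [:: 8; 9; 10; 0; 1; 4; 5; 2; 3; 6; 7]%N i))).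
move=> i; apply: val_inj.
by case: i => -[|[|[|[|[|[|[|[|[|[|[|//]]]]]]]]]]] ?; rewrite /level_rank /= [X in nth _ _ X]inordK //= inordK.
Qed.

Lemma level_sorted i j :
  (level i < level j -> perm level_rank_inj i < perm level_rank_inj j)%N.
Proof.
rewrite !permE /level /level_rank.
case: i => -[|[|[|[|[|[|[|[|[|[|[|//]]]]]]]]]]] ?;
 by case: j => -[|[|[|[|[|[|[|[|[|[|[|//]]]]]]]]]]] ?; rewrite /= ?inordK.
Qed.

Lemma level_lshift (i : 'I_8) : level (lshift 3 i) \in [:: 1; 2]%N.
Proof. by case: i => -[|[|[|[|[|[|[|[|//]]]]]]]] ?. Qed.

Lemma level_rshift (k : 'I_3) : level (rshift 8 k) = 0%N.
Proof. by case: k => -[|[|[|//]]] ?. Qed.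

Lemma level1E (i : 'I_8) : level (lshift 3 i) = 1%N -> (i : nat) \in [:: 0; 1; 4; 5]%N.
Proof. by case: i => -[|[|[|[|[|[|[|[|//]]]]]]]] ?. Qed.

Lemma level2E (i : 'I_8) : level (lshift 3 i) = 2%N -> (i : nat) \in [:: 2; 3; 6; 7]%N.
Proof. by case: i => -[|[|[|[|[|[|[|[|//]]]]]]]] ?. Qed.

Lemma mu_delta_coef i j k : mu t (delta_mx j 0) (delta_mx i 0) k 0 = J_coef t k i j.
Proof. by rewrite mu_delta J_mx_coef. Qed.

Lemma mu_coef X Y k :
  mu t X Y k 0 = \sum_(i < 8) \sum_(j < 8) J_coef t k i j * X j 0 * Y i 0.
Proof.
rewrite {1}[Y]col_sum_delta linear_sumr summxE; apply: eq_bigr => i _.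
rewrite linearZr_LR mxE {1}[X]col_sum_delta linear_sumlz summxE mulr_sumr.
apply: eq_bigr => j _; rewrite linearZl_LR mxE mu_delta_coef; ring.
Qed.

Lemma sum_iota n (F : 'I_n.+1 -> R) :
  \sum_i F i = \sum_(i <- iota 0 n.+1) F (inord i).
Proof.
rewrite -[iota _ _]/(index_iota 0 n.+1) big_mkord.
by apply: eq_bigr => i _; rewrite inord_val.
Qed.

Lemma mu_derivation_rel (D : {linear 'cV[R]_(8 + 3) -> 'cV[R]_(8 + 3)}) :
  is_derivation (bracket (mu t)) D ->
  let a i j := ulsubmx (linear_mx D) (inord i) (inord j) in
  let c k l := drsubmx (linear_mx D) (inord k) (inord l) in
  forall k i j, (k < 3)%N -> (i < 8)%N -> (j < 8)%N ->
  \sum_(l <- iota 0 3) c k l * J_coef t l i j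
  - \sum_(m <- iota 0 8) (a m j * J_coef t k i m + a m i * J_coef t k m j) = 0.
Proof.
move=> derD a c k i j k3 i8 j8; apply/eqP; rewrite subr_eq0; apply/eqP.
pose A := ulsubmx (linear_mx D).
have [+ _] := derivation_bracket derD (delta_mx (inord j) 0) (delta_mx (inord i) 0).
move=> /colP/(_ (inord k)); rewrite mxE [RHS]mxE -/A => E.
transitivity (\sum_(l < 3) drsubmx (linear_mx D) (inord k) l *
    mu t (delta_mx (inord j) 0) (delta_mx (inord i) 0) l 0).
  rewrite sum_iota !big_cons !big_nil /c.
  by rewrite !mu_delta_coef !(inordK i8, inordK j8) !inordK.
rewrite E big_split /=.
have Ad (m : 'I_8) : A *m delta_mx m 0 = \sum_l A l m *: delta_mx l 0 :> 'cV_8.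
  by rewrite -colE [LHS]col_sum_delta; apply: eq_bigr => l _; rewrite mxE.
rewrite !Ad linear_sumlz linear_sumr !summxE !sum_iota; congr (_ + _).
  apply: eq_big_seq => m; rewrite mem_iota => /andP[_ m8].
  by rewrite linearZl_LR mxE mu_delta_coef !inordK.
apply: eq_big_seq => m; rewrite mem_iota => /andP[_ m8].
by rewrite linearZr_LR mxE mu_delta_coef !inordK.
Qed.

Lemma flag_weight_level : \sum_i flag_weight R level i = 0.
Proof. by rewrite !big_ord_recl big_ord0 /flag_weight /level /=; ring. Qed.

Lemma level_le2 i : (level i <= 2)%N.
Proof. by case: i => -[|[|[|[|[|[|[|[|[|[|[|//]]]]]]]]]]] ?. Qed.

Lemma bracket_mu_derived u v i : (0 < level i)%N -> bracket (mu t) u v i 0 = 0.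
Proof.
have [k ->|k ->] := split_ordP i; first by rewrite col_mxEu mxE.
by rewrite level_rshift.
Qed.

Lemma bracket_mu_center i v : level i = 0%N -> bracket (mu t) (delta_mx i 0) v = 0.
Proof.
have [k ->|k -> _] := split_ordP i; first by move=> l0; have := level_lshift k; rewrite l0.
rewrite /bracket (_ : usubmx _ = 0) ?linear0l ?col_mx0 //.
by apply/colP => j; rewrite !mxE eq_lrshift.
Qed.

Lemma bracket_mu_abelian i j : level i = 1%N -> level j = 1%N ->
  bracket (mu t) (delta_mx i 0) (delta_mx j 0) = 0.
Proof.
have [k ->|k ->] := split_ordP i; last by rewrite level_rshift.
have [l -> /level1E lk /level1E ll|l ->] := split_ordP j; last by rewrite level_rshift.
have U (m : 'I_8) : usubmx (delta_mx (lshift 3 m) 0) = delta_mx m 0 :> 'cV[R]_8.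
  by apply/colP => a; rewrite !mxE eq_lshift.
rewrite /bracket !U (_ : mu t _ _ = 0) ?col_mx0 //.
apply/colP => a; rewrite mu_delta_coef mxE.
case: k lk ll => k /= _; rewrite !inE => /or4P[] /eqP -> /or4P[] /eqP ->;
 by case: a => -[|[|[|//]]].
Qed.

Lemma linear_mx_delta (D : {linear 'cV[R]_(8 + 3) -> 'cV[R]_(8 + 3)}) k l :
  D (delta_mx l 0) k 0 = linear_mx D k l.
Proof. by rewrite mxE. Qed.

Lemma mu_derivation_flag (D : {linear 'cV[R]_(8 + 3) -> 'cV[R]_(8 + 3)}) :
  is_derivation (bracket (mu t)) D ->
  forall k l, (level l < level k)%N -> D (delta_mx l 0) k 0 = 0.
Proof.
move=> derD k l; rewrite linear_mx_delta.
have [i ->|i ->] := split_ordP k; last by rewrite level_rshift.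
(* Entries from n_2 to n_1 vanish because every Z_j is a bracket; those from level 1 to level 2
   vanish by the certificates. *)
have [j -> ji|j -> _] := split_ordP l; last first.
  have [X [Y XY]] := mu_delta_surj t j.
  have [_ +] := derivation_bracket derD X Y; rewrite XY -colE => /colP/(_ i).
  by rewrite !mxE.
have := derivation_flag_mu t1 (mu_derivation_rel derD) (i := i) (j := j).
rewrite !inord_val !mxE; apply; [apply: level2E | apply: level1E];
  by move: ji (level_lshift i) (level_lshift j); rewrite !inE => + /orP[] /eqP ei /orP[] /eqP ej;
  rewrite ei ej.
Qed.

Lemma mu_derivation_trace (D : {linear 'cV[R]_(8 + 3) -> 'cV[R]_(8 + 3)}) :
  is_derivation (bracket (mu t)) D ->
  \sum_i flag_weight R level i * D (delta_mx i 0) i 0 = 0.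
Proof.
move=> derD; rewrite big_split_ord /= [X in _ + X]big1 ?addr0; last first.
  by move=> k _; rewrite /flag_weight level_rshift /=; ring.
under eq_bigr do rewrite linear_mx_delta.
rewrite -[RHS](derivation_trace_mu (mu_derivation_rel derD)) sum_iota.
have E p : linear_mx D (lshift 3 (inord p)) (lshift 3 (inord p)) =
    ulsubmx (linear_mx D) (inord p) (inord p) by rewrite [RHS]mxE [in RHS]mxE.
rewrite !big_cons big_nil !E /flag_weight /level /= !inordK //=.
by ring.
Qed.

Lemma mu_no_nilsoliton (g : {dot 'cV[R]_(8 + 3) for idfun}) :
  ~ is_nilsoliton (bracket (mu t)) g.
Proof.
move=> sol.
have [f fP] := nilsoliton_abelian_complement (bracket_skew (mu t)) level_le2
  level_sorted bracket_mu_derived bracket_mu_center bracket_mu_abelian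
  flag_weight_level mu_derivation_flag mu_derivation_trace sol.
pose x p i : R := usubmx (f (lshift 3 (inord p))) (inord i) 0.
have lev2 p : p \in [:: 2; 3; 6; 7]%N -> level (lshift 3 (inord p)) = 2%N.
  by rewrite !inE /level => /or4P[] /eqP -> /=; rewrite inordK.
have fI p i : p \in [:: 2; 3; 6; 7]%N -> i \in [:: 2; 3; 6; 7]%N -> x p i = (p == i)%:R.
  move=> p2 i2; have [+ _] := fP _ _ (lev2 p p2) (lev2 i i2).
  rewrite /x mxE => ->; rewrite eq_lshift -val_eqE /= !inordK //.
    by move: i2; rewrite !inE => /or4P[] /eqP ->.
  by move: p2; rewrite !inE => /or4P[] /eqP ->.
have b0 k p q : (k < 3)%N -> p \in [:: 2; 3; 6; 7]%N -> q \in [:: 2; 3; 6; 7]%N ->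
    \sum_(i <- iota 0 8) \sum_(j <- iota 0 8) J_coef t k i j * x p j * x q i = 0.
  move=> k3 p2 q2; have [_ +] := fP _ _ (lev2 p p2) (lev2 q q2).
  rewrite -[RHS]col_mx0 => /eq_col_mx[_ /colP/(_ (inord k))].
  rewrite mu_coef [RHS]mxE sum_iota => E; rewrite -[RHS]E.
  apply: eq_big_seq => i; rewrite mem_iota => /andP[_ i8]; rewrite sum_iota.
  apply: eq_big_seq => j; rewrite mem_iota => /andP[_ j8].
  by rewrite !inordK.
(* The abelian complement makes every bracket coordinate zero, so the combination with value 2
   becomes 0 = 2. *)
have := bracket_complement_mu t fI; rewrite /= !b0 // subr0 !addr0 => /eqP.
by rewrite eq_sym pnatr_eq0.
Qed.

End NoNilsoliton.

Theorem proposition4p4 (R : realType) :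
  (forall t : R, 1 < t -> nonsingular (mu t)) /\
  (forall s t : R, 1 < s -> 1 < t -> s <> t ->
     ~ lie_isomorphic (bracket (mu s)) (bracket (mu t))) /\
  (exists J0 : 'M[R]_8,
     is_skewmx J0 /\ only_pm_i_eigenvalues J0 /\
     (forall t : R, 1 < t -> forall x y z : R,
        pfaffian_form J0 (mu t) x y z =
          (x ^+ 2 + y ^+ 2 + z ^+ 2) * (x ^+ 2 + t * y ^+ 2 + z ^+ 2))) /\
  (forall t : R, 1 < t -> forall g : {dot 'cV[R]_(8 + 3) for idfun},
     ~ is_nilsoliton (bracket (mu t)) g).
Proof.
split; first exact: mu_nonsingular.
split; first by move=> s t; exact: mu_not_isomorphic.
split; last exact: mu_no_nilsoliton.
(* This is J(Z_3) for every member of the family, so one sign normalization serves all [t]. *)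
exists (J_mx 1 0 0 1); split; first exact: J_mx_skew.
split; first exact: J_mx_std_eigenvalues.
by move=> t _ x y z; exact: pfaffian_form_mu.
Qed.
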